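(* Let $\mathcal{A}$ be a unital $C^*$-algebra. The sets $\tilde{\mathcal{M}}\Phi_+^-(H_{\mathcal{A}})$ and $\tilde{\mathcal{M}}\Phi_-^+(H_{\mathcal{A}})$ are open in $B^a(H_{\mathcal{A}})$ (in the norm topology).
   Context: $\mathcal{A}$ is a unital $C^*$-algebra; $H_{\mathcal{A}} = \ell^2(\mathcal{A})$ is the standard Hilbert $\mathcal{A}$-module, and $B^a(H_{\mathcal{A}})$ is the $C^*$-algebra of bounded adjointable $\mathcal{A}$-linear operators on it. $M \tilde\oplus N$ denotes a direct sum of closed submodules that is not necessarily orthogonal. A Hilbert module is finitely generated if it is the (algebraic) $\mathcal{A}$-linear span of a finite set. An isomorphism of Hilbert modules is a bounded $\mathcal{A}$-linear bijection (with bounded inverse). $N_1 \preceq N_2$ means that $N_1$ is isomorphic to a closed submodule of $N_2$. $\tilde{\mathcal{M}}\Phi_+^-(H_{\mathcal{A}})$ is the set of $F \in B^a(H_{\mathcal{A}})$ for which there are closed submodules with $H_{\mathcal{A}} = M_1 \tilde\oplus N_1 = M_2 \tilde\oplus N_2$, $F(M_1) \subseteq M_2$, $F(N_1) \subseteq N_2$, $F|_{M_1}: M_1 \to M_2$ an isomorphism, $N_1, N_2$ finitely generated, and $N_1 \preceq N_2$. $\tilde{\mathcal{M}}\Phi_-^+(H_{\mathcal{A}})$ is defined in the same way but with $N_2 \preceq N_1$ instead. *)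

(* Defs.v *)
From HB Require Import structures.
From mathcomp Require Import all_boot all_order all_algebra.
From mathcomp Require Import all_classical all_reals all_analysis.
From mathcomp Require Import complex.
Set Implicit Arguments.
Unset Strict Implicit.
Unset Printing Implicit Defensive.
Import Order.TTheory GRing.Theory Num.Theory.
Import numFieldNormedType.Exports.
Local Open Scope classical_set_scope.
Local Open Scope ring_scope.

(* A unital C*-algebra, given as a Banach space with a product, a unit and an
   involution.  The library has no join of ring and normed module structures
   that could be extended instead (such a join cannot be inserted below
   numDomainType), so the ring structure is declared on the carrier
   afterwards.  The zero algebra is not excluded. *)
Record unitalCStarAlgType (R : realType) := UnitalCStarAlg {
  cstar_space : completeNormedModType R[i] ;
  cstar_mul : cstar_space -> cstar_space -> cstar_space ;
  cstar_one : cstar_space ;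
  cstar_star : cstar_space -> cstar_space ;
  cstar_mulA : associative cstar_mul ;
  cstar_mul1l : left_id cstar_one cstar_mul ;
  cstar_mulr1 : right_id cstar_one cstar_mul ;
  cstar_mulDl : left_distributive cstar_mul +%R ;
  cstar_mulDr : right_distributive cstar_mul +%R ;
  cstar_scaleAl : forall (c : R[i]) a b,
    c *: cstar_mul a b = cstar_mul (c *: a) b ;
  cstar_scaleAr : forall (c : R[i]) a b,
    c *: cstar_mul a b = cstar_mul a (c *: b) ;
  cstar_normM : forall a b, `|cstar_mul a b| <= `|a| * `|b| ;
  cstar_starK : involutive cstar_star ;
  cstar_starD : forall a b, cstar_star (a + b) = cstar_star a + cstar_star b ;
  cstar_starZ : forall (c : R[i]) a,
    cstar_star (c *: a) = c^* *: cstar_star a ;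
  cstar_starM : forall a b,
    cstar_star (cstar_mul a b) = cstar_mul (cstar_star b) (cstar_star a) ;
  cstar_normE : forall a, `|cstar_mul (cstar_star a) a| = `|a| ^+ 2
}.

Definition cstar_sort (R : realType) (A : unitalCStarAlgType R) : Type :=
  cstar_space A.
Coercion cstar_sort : unitalCStarAlgType >-> Sortclass.

HB.instance Definition _ (R : realType) (A : unitalCStarAlgType R) :=
  CompleteNormedModule.copy (cstar_sort A) (cstar_space A).
HB.instance Definition _ (R : realType) (A : unitalCStarAlgType R) :=
  GRing.Zmodule_isPzRing.Build (cstar_sort A)
    (@cstar_mulA R A) (@cstar_mul1l R A) (@cstar_mulr1 R A)
    (@cstar_mulDl R A) (@cstar_mulDr R A).

Definition star (R : realType) (A : unitalCStarAlgType R) : A -> A :=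
  @cstar_star R A.

Section StandardModule.
Context {R : realType} {A : unitalCStarAlgType R}.

(* H_A is a right A-module, carved out of the sequences nat -> A; its additive
   structure is the pointwise one, and its complex scalar multiplication is
   the action of the elements c *: 1 of A. *)
Definition HA : set (nat -> A) :=
  [set x | cvgn (series (fun n => star (x n) * x n))].

Definition ract (x : nat -> A) (a : A) : nat -> A := fun n => x n * a.

Definition inner (x y : nat -> A) : A :=
  limn (series (fun n => star (x n) * y n)).

(* The norm of A is a nonnegative real number, seen as an element of R[i]. *)
Definition normH (x : nat -> A) : R := Num.sqrt (complex.Re `|inner x x|).

Definition linear_on (M : set (nat -> A)) (u : (nat -> A) -> (nat -> A)) :=
  forall x y a, M x -> M y -> u (x + ract y a) = u x + ract (u y) a.

Definition bounded_on (M : set (nat -> A)) (u : (nat -> A) -> (nat -> A)) :=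
  exists c : R, forall x, M x -> normH (u x) <= c * normH x.

Definition closed_in_HA (M : set (nat -> A)) :=
  forall x, HA x ->
    (forall e : R, 0 < e -> exists2 y, M y & normH (x - y) < e) -> M x.

Definition closed_submodule (M : set (nat -> A)) :=
  [/\ M `<=` HA, M 0,
      forall x y, M x -> M y -> M (x + y),
      forall x a, M x -> M (ract x a)
    & closed_in_HA M].

Definition direct_sum (M N : set (nat -> A)) :=
  [/\ closed_submodule M, closed_submodule N,
      HA = [set x + y | x in M & y in N] & M `&` N = [set 0]].

Definition finitely_generated (N : set (nat -> A)) :=
  exists (k : nat) (g : 'I_k -> (nat -> A)),
    N = [set x | exists a : 'I_k -> A, x = \sum_(i < k) ract (g i) (a i)].

Definition module_iso (M N : set (nat -> A)) (u : (nat -> A) -> (nat -> A)) :=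
  [/\ linear_on M u, set_bij M N u, bounded_on M u
    & exists c : R, forall x, M x -> normH x <= c * normH (u x)].

Definition preceq (N1 N2 : set (nat -> A)) :=
  exists N u, [/\ closed_submodule N, N `<=` N2 & module_iso N1 N u].

(* An operator on H_A is represented by its extension by 0 to all
   sequences, so that equality of operators is equality of functions. *)
Record Ba := MkBa {
  op :> (nat -> A) -> (nat -> A) ;
  op_fun : set_fun HA HA op ;
  op_out : forall x, ~ HA x -> op x = 0 ;
  op_linear : linear_on HA op ;
  op_bounded : bounded_on HA op ;
  op_adjoint : exists2 G : (nat -> A) -> (nat -> A), set_fun HA HA G &
    forall x y, HA x -> HA y -> inner (op x) y = inner x (G y)
}.

Definition opnorm (T : (nat -> A) -> (nat -> A)) : R :=
  sup [set normH (T x) | x in [set x | HA x /\ normH x <= 1]].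

Definition open_in_Ba (S : set Ba) :=
  forall F, S F -> exists2 e : R, 0 < e &
    forall G : Ba, opnorm (fun x => G x - F x) < e -> S G.

Definition MPhi_decomposition (F : Ba) (M1 N1 M2 N2 : set (nat -> A)) :=
  [/\ direct_sum M1 N1 /\ direct_sum M2 N2,
      set_fun M1 M2 F, set_fun N1 N2 F, module_iso M1 M2 F
    & finitely_generated N1 /\ finitely_generated N2].

Definition MPhi_plus_minus : set Ba :=
  [set F | exists M1 N1 M2 N2,
     MPhi_decomposition F M1 N1 M2 N2 /\ preceq N1 N2].

Definition MPhi_minus_plus : set Ba :=
  [set F | exists M1 N1 M2 N2,
     MPhi_decomposition F M1 N1 M2 N2 /\ preceq N2 N1].

End StandardModule.

Arguments Ba {R} A.
Arguments MPhi_plus_minus {R} A.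
Arguments MPhi_minus_plus {R} A.

(* Main.v *)
Require Import Defs.
From HB Require Import structures.
From mathcomp Require Import all_boot all_order all_algebra.
From mathcomp Require Import all_classical all_reals all_analysis.
From mathcomp Require Import complex ring lra.
Set Implicit Arguments.
Unset Strict Implicit.
Unset Printing Implicit Defensive.
Import Order.TTheory GRing.Theory Num.Theory.
Import numFieldNormedType.Exports.
Local Open Scope classical_set_scope.
Local Open Scope ring_scope.
Local Open Scope complex_scope.

(** When F is perturbed to G, two of the four summands can be kept and the two
    others are given by explicit formulas.  Let F be diagonal for
    M1 (+) N1 -> M2 (+) N2, with F : M1 -> M2 an isomorphism, so that
    (m, n) |-> F m + n is a bounded bijection from M1 x N2 onto H_A.  By the
    open mapping principle its inverse is bounded, and for G close to F the map
    (m, n) |-> G m + n is again a bijection with bounded inverse.  Hence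
    H_A = G(M1) (+) N2, and H_A = M1 (+) G^-1(N2) follows at once; G is
    diagonal for these two splittings and an isomorphism on M1.  The summand
    N2 is the old one, and G^-1(N2) is isomorphic to N1 because both are
    complements of M1; finite generation and the comparison of N1 with N2 are
    therefore inherited ([decomposition_stable], [complements_iso]).

    The two analytic facts, boundedness of the projections of a splitting
    ([complement_bound]) and stability of a splitting
    ([perturbed_splitting]), hold in every Banach space and both come from the
    same successive approximation; the first one also uses Baire's theorem.
    To apply them one has to know that H_A is a Banach space, which rests on
    the order structure of the C*-algebra: sums of elements a^* a are positive
    and the norm is monotone on positive elements.  The triangle inequality
    then follows from
      (x + y)^*(x + y) <= (1 + t) x^* x + (1 + 1/t) y^* y    (t > 0),
    with t chosen as the ratio of the two norms.

    Positivity is developed without spectral theory.  An element h is positive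
    if it is self-adjoint and |t - h| <= t for some t; this is visibly stable
    under sums.  Square roots come from the iteration r |-> (d + r^2) / 2.
    That squares are positive is seen on the unitary u = k + i sqrt(1 - k^2):
    2 k^2 - 1 is the real part of u^2, so its norm is at most 1.  That x^* x is
    positive is the classical argument with the negative part of x^* x, where
    the spectrum of a product is avoided by passing to the polynomial identities
    in [pos_cadj_mul]. *)

(** * The C*-algebra as a real Banach space *)

Section Realification.
Variables (R : realType) (A : unitalCStarAlgType R).

(** A copy of A over the real scalars: its norm takes values in the real field,
    where linear arithmetic is available, instead of in R[i]. *)
Definition realA : Type := A.

HB.instance Definition _ := GRing.PzRing.copy realA (cstar_sort A).

Definition rscale (t : R) (a : realA) : realA := t%:C *: (a : A).

Lemma rscaleA s t a : rscale s (rscale t a) = rscale (s * t) a.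
Proof. by rewrite /rscale scalerA -rmorphM. Qed.
Lemma rscale1 : left_id 1 rscale.
Proof. by move=> a; rewrite /rscale scale1r. Qed.
Lemma rscaleDr : right_distributive rscale +%R.
Proof. by move=> t a b; rewrite /rscale -scalerDr. Qed.
Lemma rscaleDl a : {morph rscale^~ a : s t / s + t}.
Proof. by move=> s t; rewrite /rscale rmorphD scalerDl. Qed.

HB.instance Definition _ :=
  GRing.Zmodule_isLmodule.Build R realA rscaleA rscale1 rscaleDr rscaleDl.

Definition rnorm (a : realA) : R := complex.Re `|a : A|.

Lemma rnormE (a : A) : `|a| = (rnorm a)%:C.
Proof. by rewrite /rnorm RRe_real// normr_real. Qed.

Lemma rnormD x y : rnorm (x + y) <= rnorm x + rnorm y.
Proof. by rewrite -lecR rmorphD/= -!rnormE ler_normD. Qed.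
Lemma rnormZ (t : R) x : rnorm (t *: x) = `|t| * rnorm x.
Proof.
apply: (@complexI R); rewrite rmorphM/= -!rnormE normrZ; congr (_ * _).
by rewrite normc_def/= expr0n/= addr0 sqrtr_sqr.
Qed.
Lemma rnorm0_eq0 x : rnorm x = 0 -> x = 0.
Proof.
by move=> x0; apply/(@normr0_eq0 _ (cstar_space A)); rewrite rnormE x0.
Qed.

HB.instance Definition _ :=
  @Lmodule_isNormed.Build R realA rnorm rnormD rnormZ rnorm0_eq0.

Lemma gt0_complexE (e : R[i]) : 0 < e -> exists2 d : R, 0 < d & e = d%:C.
Proof.
by case: e => a b; rewrite ltcE/= => /andP[/eqP -> a0]; exists a.
Qed.

(** The real norm defines the topology of A, so limits may be computed in either
    of the two structures. *)
Lemma realA_cvgP (F : set_system A) (FF : Filter F) (l : A) :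
  (F --> l) <-> ((F : set_system realA) --> (l : realA)).
Proof.
split=> [/cvgrPdist_lt Fl|/cvgrPdist_lt Fl]; apply/cvgrPdist_lt => e e0.
- have := Fl e%:C; rewrite ltcR => /(_ e0); apply: filterS => x.
  by rewrite -ltcR -rnormE.
- have [d d0 ->] := gt0_complexE e0.
  by have := Fl d d0; apply: filterS => x; rewrite -ltcR -rnormE.
Qed.

Lemma realA_complete (F : set_system realA) : ProperFilter F ->
  cauchy F -> cvg F.
Proof.
move=> FF /cauchy_ballP Fc.
have : cauchy (F : set_system A).
  apply/cauchy_ballP => e e0; have [d d0 ->] := gt0_complexE e0.
  have := Fc d d0; apply: filterS => -[x y] /=.
  by rewrite -!ball_normE/= => xy; rewrite rnormE ltcR.
move=> /cauchy_cvg/cvg_ex[l Fl]; apply/cvg_ex; exists l.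
exact/realA_cvgP.
Qed.

HB.instance Definition _ := Uniform_isComplete.Build realA realA_complete.
End Realification.

(** * Cauchy sequences *)

Section Sequences.
Variables (R : realType) (V : completeNormedModType R).
Implicit Types u : nat -> V.

Lemma cvgn_cauchyP u : cvgn u <-> forall e : R, 0 < e ->
  exists N : nat, forall n m, (N <= n)%N -> (n <= m)%N -> `|u m - u n| < e.
Proof.
split=> [uc e e0|H].
  have e20 : 0 < e / 2 by rewrite divr_gt0.
  move/cvgrPdist_lt : uc => /(_ _ e20)[N _ HN]; exists N => n m Nn nm.
  have := HN n Nn; have := HN m (leq_trans Nn nm) => /= h1 h2.
  rewrite -(subrKA (limn u)) (le_lt_trans (ler_normD _ _))// distrC.
  by rewrite [e]splitr ltrD.
apply/cauchy_cvgP/cauchy_exP => e e0; have [N HN] := H e e0.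
exists (u N), N => // n /= Nn.
by rewrite -ball_normE/= distrC HN.
Qed.

End Sequences.

Section DominatedSequences.
Variables (R : realType) (V : completeNormedModType R).

(** The increments of u are dominated by those of a convergent real sequence;
    summing them up shows that u is Cauchy. *)
Lemma cvgn_dominated (u : nat -> V) (s : nat -> R) : cvgn s ->
  (forall n, `|u n.+1 - u n| <= s n.+1 - s n) -> cvgn u.
Proof.
move=> /cvgn_cauchyP sc us; apply/cvgn_cauchyP => e e0.
have [N HN] := sc e e0; exists N => n m Nn nm.
suff : `|u m - u n| <= s m - s n.
  by move=> /le_lt_trans; apply; rewrite (le_lt_trans (ler_norm _))// HN.
elim: m nm => [|m IH]; first by rewrite leqn0 => /eqP ->; rewrite !subrr normr0.
rewrite leq_eqVlt => /predU1P[->|]; first by rewrite !subrr normr0.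
rewrite ltnS => /IH{}IH.
rewrite -(subrKA (u m)) (le_trans (ler_normD _ _))//.
by have := us m; move: IH; lra.
Qed.

End DominatedSequences.

(** * The involution and square roots *)

Section CStarBasics.
Variables (R : realType) (A : unitalCStarAlgType R).
Local Notation B := (realA A).
Implicit Types (a b c d h x y : B) (t : R).

Definition cadj (a : B) : B := star (a : A).
(** The imaginary unit as an element of A: it turns complex combinations into
    ring expressions. *)
Definition iu : B := 'i%C *: (1 : A).

Lemma rscaleE t a : t *: a = (t%:C *: (a : A) : B).
Proof. by []. Qed.

Lemma normBE a : (`|a : A|) = (`|a|)%:C.
Proof. exact: rnormE. Qed.

Lemma rscalerAl t a b : t *: (a * b) = t *: a * b.
Proof. exact: (@cstar_scaleAl R A). Qed.

Lemma rscalerAr t a b : t *: (a * b) = a * (t *: b).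
Proof. exact: (@cstar_scaleAr R A). Qed.

Lemma rscalerM s t a b : (s *: a) * (t *: b) = (s * t) *: (a * b).
Proof. by rewrite -rscalerAl -rscalerAr scalerA. Qed.

Lemma normBM a b : `|a * b| <= `|a| * `|b|.
Proof. by rewrite -lecR rmorphM/= -!normBE (@cstar_normM R A). Qed.

Lemma cadjK : involutive cadj. Proof. exact: (@cstar_starK R A). Qed.
Lemma cadjD : {morph cadj : a b / a + b}. Proof. exact: (@cstar_starD R A). Qed.
Lemma cadjM a b : cadj (a * b) = cadj b * cadj a.
Proof. exact: (@cstar_starM R A). Qed.
Lemma cadjZ t a : cadj (t *: a) = t *: cadj a.
Proof.
by rewrite rscaleE /cadj /star cstar_starZ conj_Creal// complex_real eqxx.
Qed.
Lemma cadjN a : cadj (- a) = - cadj a.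
Proof. by rewrite -scaleN1r cadjZ scaleN1r. Qed.
Lemma cadjB a b : cadj (a - b) = cadj a - cadj b.
Proof. by rewrite cadjD cadjN. Qed.
Lemma cadj0 : cadj 0 = 0.
Proof. by rewrite -[in LHS](subrr 0) cadjB subrr. Qed.
Lemma cadj1 : cadj 1 = 1.
Proof. by have := cadjM (cadj 1) 1; rewrite mulr1 cadjK mulr1. Qed.

Lemma norm_cadjM a : `|cadj a * a| = `|a| ^+ 2.
Proof.
by apply: (@complexI R); rewrite -normBE (@cstar_normE R A) normBE -rmorphXn.
Qed.

Lemma norm_cadj a : `|cadj a| = `|a|.
Proof.
suff H b : `|b| <= `|cadj b| by apply/eqP; rewrite eq_le -{2}(cadjK a) !H.
have [->|b0] := eqVneq b 0; first by rewrite normr0.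
have : `|b| * `|b| <= `|cadj b| * `|b| by rewrite -expr2 -norm_cadjM normBM.
by rewrite ler_pM2r// normr_gt0.
Qed.

Lemma norm_sqr_selfadj h : cadj h = h -> `|h * h| = `|h| ^+ 2.
Proof. by move=> hh; rewrite -norm_cadjM hh. Qed.

Lemma normB1_le1 : `|1 : B| <= 1.
Proof.
have [->|b0] := eqVneq (1 : B) 0; first by rewrite normr0.
have := norm_cadjM 1; rewrite cadj1 mulr1 expr2 => /esym/(canRL (mulfK _)) ->.
  by rewrite divff// normr_eq0.
by rewrite normr_eq0.
Qed.

(** Only an inequality, since the zero algebra has |1| = 0. *)
Lemma norm_cst t : 0 <= t -> `|t *: (1 : B)| <= t.
Proof.
by move=> t0; rewrite normrZ ger0_norm// ler_piMr// normB1_le1.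
Qed.

Lemma iuC a : iu * a = a * iu.
Proof.
have -> : iu * a = 'i%C *: ((1 : A) * (a : A)) by rewrite (@cstar_scaleAl R A).
by rewrite mul1r -[in LHS](mulr1 (a : A)) [LHS](@cstar_scaleAr R A).
Qed.

Lemma cadj_iu : cadj iu = - iu.
Proof.
rewrite /cadj /star cstar_starZ.
have -> : (('i%C : R[i])^*)%R = - 'i%C.
  by apply/eqP; rewrite eq_complex/= oppr0 !eqxx.
by rewrite -[cstar_star _]/(cadj 1) cadj1 scaleNr.
Qed.

Lemma iu_sqr : iu * iu = -1.
Proof.
rewrite /iu -[LHS](@cstar_scaleAl R A) [X in _ *: X]mul1r scalerA.
by rewrite -expr2 sqr_i scaleN1r.
Qed.

Lemma cvgB_M (u v : nat -> B) a b :
  u @ \oo --> a -> v @ \oo --> b -> (fun n => u n * v n) @ \oo --> a * b.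
Proof.
move=> ua vb; apply/subr_cvg0; apply: norm_cvg0.
have cvg0 (w : nat -> B) c :
    w @ \oo --> c -> `|w n - c| @[n --> \oo] --> (0 : R).
  by move=> wc; rewrite -(normr0 B); apply: cvg_norm; apply/subr_cvg0.
apply: (squeeze_cvgr (f := cst 0)
  (h := fun n => `|u n - a| * `|v n| + `|a| * `|v n - b|)).
- apply: nearW => n /=; rewrite normr_ge0/=.
  have -> : u n * v n - a * b = (u n - a) * v n + a * (v n - b).
    by rewrite mulrBl mulrBr addrA subrK.
  by rewrite (le_trans (ler_normD _ _))// lerD// normBM.
- exact: cvg_cst.
- rewrite (_ : 0 = 0 * `|b| + `|a| * 0); last by rewrite mul0r mulr0 addr0.
  apply: cvgD; apply: cvgM.
  - exact: cvg0.
  - exact: cvg_norm.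
  - exact: cvg_cst.
  - exact: cvg0.
Qed.

Lemma cvg_cadj (u : nat -> B) a :
  u @ \oo --> a -> (fun n => cadj (u n)) @ \oo --> cadj a.
Proof.
move=> /cvgrPdist_lt ua; apply/cvgrPdist_lt => e e0.
by apply: filterS (ua e e0) => n; rewrite -cadjB norm_cadj.
Qed.

(** The iteration r_{n+1} = (d + r_n^2) / 2 converges to 1 - sqrt (1 - d).  All
    r_n commute, so the increments of r are dominated by those of the scalar
    iteration s started with d = 1, which increases and is bounded by 1; this
    covers the boundary case |d| = 1 as well.  The limit inherits from the r_n
    self-adjointness and commutation with everything that commutes with d. *)
Lemma sqrt_exists d : `|d| <= 1 -> exists b, [/\ b * b = 1 - d, `|1 - b| <= 1,
  cadj d = d -> cadj b = b & forall x, x * d = d * x -> x * b = b * x].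
Proof.
move=> d1.
pose r := fix r n : B := if n is m.+1 then 2^-1 *: (d + r m * r m) else 0.
pose s := fix s n : R := if n is m.+1 then 2^-1 * (1 + s m * s m) else 0.
have rS n : r n.+1 = 2^-1 *: (d + r n * r n) by [].
have sS n : s n.+1 = 2^-1 * (1 + s n * s n) by [].
have s01 n : 0 <= s n <= 1.
  elim: n => [|n /andP[s0 s1]]; first by rewrite /= lexx ler01.
  by rewrite sS; apply/andP; split; nra.
have r_comm x : x * d = d * x -> forall n, x * r n = r n * x.
  move=> xd; elim=> [|n IH]; first by rewrite mulr0 mul0r.
  rewrite rS -rscalerAr -rscalerAl mulrDr mulrDl xd; congr (_ *: (_ + _)).
  by rewrite mulrA IH -!mulrA IH.
have rr n m : r n * r m = r m * r n.
  by apply: (r_comm (r n)); rewrite (r_comm d).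
have rs n : `|r n| <= s n /\ `|r n.+1 - r n| <= s n.+1 - s n.
  elim: n => [|n [IH1 IH2]].
    split; first by rewrite normr0.
    by rewrite /= !mulr0 addr0 !subr0 addr0 normrZ ger0_norm// mulr1 ler_piMr.
  have IH3 : `|r n.+1| <= s n.+1.
    rewrite -(subrK (r n) (r n.+1)) (le_trans (ler_normD _ _))//.
    by move: IH1 IH2; lra.
  split=> //.
  have -> : r n.+2 - r n.+1 = 2^-1 *: ((r n.+1 - r n) * (r n.+1 + r n)).
    rewrite rS [in X in _ - X]rS -scalerBr; congr (_ *: _).
    rewrite opprD addrACA subrr add0r mulrBl !mulrDr (rr n n.+1).
    by rewrite opprD addrA addrK.
  have -> : s n.+2 - s n.+1 = 2^-1 * ((s n.+1 - s n) * (s n.+1 + s n)).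
    by rewrite sS [in X in _ - X]sS; ring.
  rewrite normrZ ger0_norm// ler_pM2l// (le_trans (normBM _ _))//.
  rewrite ler_pM// (le_trans (ler_normD _ _))// lerD//.
have sc : cvgn s.
  apply: nondecreasing_is_cvgn.
    apply/nondecreasing_seqP => n; rewrite -subr_ge0.
    by case: (rs n) => _; apply: le_trans.
  by exists 1 => _ [n _ <-]; case/andP: (s01 n).
have /cvg_ex[rho rrho] : cvgn r.
  by apply: cvgn_dominated sc _ => n; case: (rs n).
have rhoE : rho = 2^-1 *: (d + rho * rho).
  have rsh : (fun n => r n.+1) @ \oo --> rho by rewrite (cvg_shiftS r).
  apply: (cvg_unique _ rsh) => //.
  by apply: cvgZl_tmp; apply: cvgD; [exact: cvg_cst|exact: cvgB_M].
exists (1 - rho); split.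
- have -> : d = 2 *: rho - rho * rho.
    by rewrite [in 2 *: rho]rhoE scalerA divff// scale1r addrK.
  by rewrite mulrBl mul1r mulrBr mulr1 scaler_nat mulr2n !opprD !opprK !addrA.
- have -> : 1 - (1 - rho) = rho by rewrite opprB addrC subrK.
  rewrite -(cvg_lim _ (cvg_norm rrho))//; apply: limr_le.
    by apply/cvg_ex; exists `|rho|; exact: cvg_norm.
  apply: nearW => n; have [rn _] := rs n; apply: le_trans rn _.
  by case/andP: (s01 n).
- move=> dd; rewrite cadjB cadj1; congr (_ - _).
  have H n : cadj (r n) = r n.
    by elim: n => [|n IH]; rewrite ?cadj0// rS cadjZ cadjD cadjM IH dd.
  have := cvg_cadj rrho; under eq_fun do rewrite H.
  by move=> /cvg_unique; apply => //.
- move=> x xd; rewrite mulrBr mulrBl mulr1 mul1r; congr (_ - _).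
  have : (fun n => x * r n) @ \oo --> x * rho.
    by apply: cvgB_M => //; exact: cvg_cst.
  under eq_fun do rewrite (r_comm _ xd).
  move=> /cvg_unique; apply => //; apply: cvgB_M => //; exact: cvg_cst.
Qed.

End CStarBasics.

(** * Positive elements *)

Section Positivity.
Variables (R : realType) (A : unitalCStarAlgType R).
Local Notation B := (realA A).
Local Notation "t %:B" := (t *: (1 : B)) (at level 2, format "t %:B").
Implicit Types (a b c d g h k l m u v x y z : B) (s t : R).

(** The norm condition is a way to say that the spectrum of h lies in [0, 2 t];
    in this form it is stable under addition. *)
Definition pos h := cadj h = h /\ exists t, `|t%:B - h| <= t.

(** For a self-adjoint and b skew-adjoint, this computes twice the real part of
    (a + b)^2 (c = a, d = b) and z z^* + z^* z for z = a + b
    (c = a, d = - b). *)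
Lemma parallelogram_mul a b c d :
  (a + b) * (c + d) + (a - b) * (c - d) = (a * c + b * d) *+ 2.
Proof.
rewrite mulrDl mulrBl !mulrDr !mulrN opprD !opprK.
rewrite (AC ((2*2)*(2*2)) (((1*4)*(5*8))*((2*6)*(3*7))))/= !subrr !addr0.
by rewrite -mulr2n.
Qed.

(** The square root of h is sqrt t times that of h / t, which exists since
    1 - h / t has norm at most 1. *)
Lemma pos_sqrt h : pos h -> exists k, [/\ cadj k = k, pos k, k * k = h &
  forall x, x * h = h * x -> x * k = k * x].
Proof.
move=> [hh [t ht]].
have : 0 <= t by apply: le_trans ht.
rewrite le_eqVlt => /predU1P[t0|t0].
  move: ht; rewrite -t0 scale0r sub0r normrN normr_le0 => /eqP ->.
  exists 0; split; rewrite ?cadj0 ?mulr0 ?mul0r//.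
    by split; [exact: cadj0|exists 0; rewrite scale0r subr0 normr0].
have st0 : 0 < Num.sqrt t by rewrite sqrtr_gt0.
have d1 : `|1 - t^-1 *: h| <= 1.
  rewrite -(ler_pM2l t0) mulr1 -{1}(gtr0_norm t0) -normrZ scalerBr scalerA.
  by rewrite divff ?gt_eqF// scale1r.
have [b [bb b1 bs bc]] := sqrt_exists d1.
have bsa : cadj b = b by apply: bs; rewrite cadjB cadj1 cadjZ hh.
exists (Num.sqrt t *: b); split.
- by rewrite cadjZ bsa.
- split; first by rewrite cadjZ bsa.
  by exists (Num.sqrt t); rewrite -scalerBr normrZ gtr0_norm// ler_piMr// ltW.
- rewrite rscalerM -expr2 sqr_sqrtr ?ltW// bb opprB addrC subrK scalerA.
  by rewrite divff ?gt_eqF// scale1r.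
- move=> x xh; rewrite -rscalerAr -rscalerAl; congr (_ *: _); apply: bc.
  by rewrite mulrBr mulrBl mulr1 mul1r -rscalerAr -rscalerAl xh.
Qed.

(** Writing k = cos s, the element u = k + i sqrt (1 - k^2) is e^(i s), hence
    unitary, and 2 k^2 - 1 = cos (2 s) is the real part of u^2. *)
Lemma norm_sqr_cos k : cadj k = k -> `|k| <= 1 -> `|(k * k) *+ 2 - 1| <= 1.
Proof.
move=> kk k1.
have d1 : `|k * k| <= 1.
  by rewrite norm_sqr_selfadj// expr_le1.
have [c [cc _ cs ccom]] := sqrt_exists d1.
have {}cs : cadj c = c by apply: cs; rewrite cadjM kk.
have ck : k * c = c * k by apply: ccom; rewrite mulrA.
pose x := iu A * c.
have xx : x * x = - (c * c).
  by rewrite /x mulrA -(mulrA (iu A) c) -(iuC c) mulrA iu_sqr mulN1r mulNr.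
have xk : x * k = k * x by rewrite /x -mulrA -ck !mulrA iuC.
have xs : cadj x = - x by rewrite /x cadjM cs cadj_iu mulrN iuC.
have us : cadj (k + x) * (k + x) = 1.
  rewrite cadjD kk xs mulrBl !mulrDr xk opprD addrA addrK xx opprK.
  by rewrite cc addrC subrK.
have u1 : `|k + x| <= 1.
  rewrite -(@expr_le1 _ 2)// -norm_cadjM us; exact: normB1_le1.
have E : (k * k *+ 2 - 1) *+ 2 = (k + x) * (k + x) + (k - x) * (k - x).
  rewrite parallelogram_mul xx cc opprB; congr (_ *+ 2).
  by rewrite mulr2n addrA.
have : `|(k * k *+ 2 - 1) *+ 2| <= 1 *+ 2.
  rewrite E [leRHS]mulr2n (le_trans (ler_normD _ _))// lerD//.
    by rewrite (le_trans (normBM _ _))// mulr_ile1.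
  have -> : k - x = cadj (k + x) by rewrite cadjD kk xs.
  by rewrite (le_trans (normBM _ _))// norm_cadj mulr_ile1.
by rewrite -scaler_nat normrZ gtr0_norm// -[leRHS]mulr_natl ler_pM2l.
Qed.

(** The previous estimate, rescaled: t = |h| / 2 already witnesses the
    positivity of h = k^2.  This sharp constant drives [pos_antisym] and
    [pos_le_norm]. *)
Lemma norm_sqr_shift k s : cadj k = k -> `|k * k| <= 2 * s ->
  `|s%:B - k * k| <= s.
Proof.
move=> kk ks.
have : 0 <= s by have := le_trans (normr_ge0 _) ks; rewrite pmulr_rge0.
rewrite le_eqVlt => /predU1P[s0|s0].
  move: ks; rewrite -s0 mulr0 normr_le0 => /eqP ->.
  by rewrite scale0r subr0 normr0.
pose r := Num.sqrt (2 * s).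
have s20 : 0 < 2 * s by rewrite mulr_gt0.
have r0 : 0 < r by rewrite sqrtr_gt0.
have rr : r * r = 2 * s by rewrite -expr2 sqr_sqrtr// ltW.
have k1 : `|r^-1 *: k| <= 1.
  rewrite -(@expr_le1 _ 2)// normrZ exprMn -norm_sqr_selfadj//.
  rewrite ger0_norm ?invr_ge0 ?(ltW r0)// exprVn expr2 rr.
  by rewrite ler_pdivrMl// mulr1.
have ksa : cadj (r^-1 *: k) = r^-1 *: k by rewrite cadjZ kk.
have := norm_sqr_cos ksa k1.
rewrite rscalerM -invfM rr -(ler_pM2l s0) mulr1 -{1}(gtr0_norm s0) -normrZ.
rewrite scalerBr -scaler_nat !scalerA invfM.
have -> : s * (2%:R * (2^-1 * s^-1)) = 1 by field; rewrite gt_eqF.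
by rewrite scale1r distrC.
Qed.

Lemma pos_norm h s : pos h -> `|h| <= 2 * s -> `|s%:B - h| <= s.
Proof. by move=> /pos_sqrt[k [kk _ <- _]]; exact: norm_sqr_shift. Qed.

Lemma pos_sqr k : cadj k = k -> pos (k * k).
Proof.
move=> kk; split; first by rewrite cadjM kk.
by exists `|k * k|; apply: norm_sqr_shift; rewrite // ler_peMl// ler1n.
Qed.

Lemma pos_cst t : 0 <= t -> pos t%:B.
Proof.
move=> t0; split; first by rewrite cadjZ cadj1.
by exists t; rewrite subrr normr0.
Qed.

Lemma posD h k : pos h -> pos k -> pos (h + k).
Proof.
move=> [hh [t ht]] [kk [s ks]]; split; first by rewrite cadjD hh kk.
exists (t + s); rewrite scalerDl opprD addrACA.
by rewrite (le_trans (ler_normD _ _))// lerD.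
Qed.

Lemma posZ t h : 0 <= t -> pos h -> pos (t *: h).
Proof.
move=> t0 [hh [s hs]]; split; first by rewrite cadjZ hh.
by exists (t * s); rewrite -scalerA -scalerBr normrZ ger0_norm// ler_wpM2l.
Qed.

Lemma pos_norm_sub h : cadj h = h -> pos ((`|h|)%:B - h).
Proof.
move=> hh; split; first by rewrite cadjB cadjZ cadj1 hh.
by exists `|h|; rewrite opprB addrC subrK.
Qed.

(** Otherwise both |h|/2 - h and |h|/2 + h would have norm at most |h|/2, and
    their difference 2 h norm at most |h|. *)
Lemma pos_antisym h : pos h -> pos (- h) -> h = 0.
Proof.
move=> ph pNh; apply/normr0_eq0/eqP; rewrite eq_le normr_ge0 andbT.
have h2 : `|h| <= 2 * (`|h| / 2) by rewrite mulrCA divff ?mulr1.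
have Nh2 : `|- h| <= 2 * (`|h| / 2) by rewrite normrN.
have := pos_norm ph h2; have := pos_norm pNh Nh2.
set e := _%:B => H1 H2.
have : `|(e - - h) - (e - h)| <= `|h| / 2 + `|h| / 2.
  by rewrite (le_trans (ler_normB _ _))// lerD.
rewrite opprK opprB [X in `|X|]addrC addrA subrK -mulr2n -scaler_nat.
by rewrite normrZ ger0_norm//; have := normr_ge0 h; lra.
Qed.

Lemma posD_eq0 h k : pos h -> pos k -> h + k = 0 -> h = 0.
Proof.
move=> ph pk /eqP; rewrite addr_eq0 => /eqP hk; apply: pos_antisym => //.
by rewrite hk opprK.
Qed.

Lemma selfadj_sqr_eq0 h : cadj h = h -> h * h = 0 -> h = 0.
Proof.
move=> hh h0; apply/normr0_eq0/eqP; rewrite -sqrf_eq0 -norm_sqr_selfadj//.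
by rewrite h0 normr0.
Qed.

(** For z = u + i v with u and v self-adjoint, this sum is 2 (u^2 + v^2). *)
Lemma pos_mul_cadj_add z : pos (z * cadj z + cadj z * z).
Proof.
pose u := 2^-1 *: (z + cadj z); pose v := 2^-1 *: (iu A * (cadj z - z)).
pose p := iu A * v.
have us : cadj u = u by rewrite /u cadjZ cadjD cadjK addrC.
have vs : cadj v = v.
  by rewrite /v cadjZ cadjM cadjB cadjK cadj_iu mulrN -mulNr opprB iuC.
have pE : p = 2^-1 *: (z - cadj z).
  by rewrite /p /v -rscalerAr mulrA iu_sqr mulN1r opprB.
have zE : z = u + p.
  rewrite pE /u -scalerDr addrACA subrr addr0 -mulr2n -(scaler_nat 2 z) scalerA.
  by rewrite mulVf ?scale1r// pnatr_eq0.
have zsE : cadj z = u - p.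
  rewrite pE /u -scalerBr opprB addrC addrA subrK -mulr2n.
  rewrite -(scaler_nat 2 (cadj z)) scalerA.
  by rewrite mulVf ?scale1r// pnatr_eq0.
have -> : z * cadj z + cadj z * z = (u * u + v * v) *+ 2.
  have -> : v * v = p * - p.
    by rewrite mulrN /p mulrA -(mulrA _ v) -iuC mulrA iu_sqr mulN1r mulNr opprK.
  by rewrite -parallelogram_mul opprK -zE -zsE.
by rewrite -scaler_nat; apply: posZ => //; apply: posD; exact: pos_sqr.
Qed.

(** Let h = x^* x, m = |h| = sqrt (h^2), and g = m - h, which is twice the
    negative part of h.  Then 2 m g = g^2 and 2 h g = - g^2, so y = x g
    satisfies y^* y = - k^2 with k = (sqrt m) g.  Multiplying once more by k
    gives z = y k with z^* z = - p^2 for p = k^2 and z z^* = - q^2 for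
    q = y y^*.  But z z^* + z^* z is positive, so p and q vanish; then k = 0,
    hence g = 0 and h = m. *)
Lemma pos_cadj_mul x : pos (cadj x * x).
Proof.
pose h := cadj x * x.
have hh : cadj h = h by rewrite /h cadjM cadjK.
have [m [ms pm mm mC]] := pos_sqrt (pos_sqr hh).
have [l [ls _ ll lC]] := pos_sqrt pm.
have mh : m * h = h * m by rewrite mC// mulrA.
pose g := m - h.
have gs : cadj g = g by rewrite /g cadjB ms hh.
have gm : m * g = g * m by rewrite /g mulrBr mulrBl mh.
have gl : g * l = l * g by apply: lC; rewrite gm.
have mg : (m * g) *+ 2 = g * g.
  rewrite [in RHS]/g mulrBl -/g /g !mulrBr mm mh mulr2n opprB.
  by rewrite [_ - h * m + _]addrC.
have hg : (h * g) *+ 2 = - (g * g).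
  rewrite -mg /g !mulrBr mm mh -mulNrn opprB //.
pose k := l * g.
have ks : cadj k = k by rewrite /k cadjM ls gs gl.
have kk : k * k = m * g * g.
  by rewrite /k -mulrA (mulrA g) gl -mulrA mulrA ll mulrA.
pose y := x * g.
have yy : cadj y * y = - (k * k).
  have -> : cadj y * y = g * (h * g).
    by rewrite /y cadjM gs -mulrA (mulrA _ x) -/h.
  have two0 : 2%:R != 0 :> R by rewrite pnatr_eq0.
  apply: (scalerI two0); rewrite !scaler_nat mulNrn -mulrnAr hg mulrN.
  congr (- _).
  by rewrite kk -mulrnAl mg mulrA.
pose z := y * k.
have zz : cadj z * z = - ((k * k) * (k * k)).
  by rewrite /z cadjM ks -mulrA (mulrA (cadj y)) yy mulNr !mulrN !mulrA.
have zz' : z * cadj z = - ((y * cadj y) * (y * cadj y)).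
  rewrite /z cadjM ks -mulrA [k * _]mulrA -[k * k]opprK -yy.
  by rewrite mulNr mulrN !mulrA.
have ysa : cadj (y * cadj y) = y * cadj y by rewrite cadjM cadjK.
have ksa : cadj (k * k) = k * k by rewrite cadjM ks.
have S0 : (y * cadj y) * (y * cadj y) + (k * k) * (k * k) = 0.
  apply: pos_antisym; first by apply: posD; exact: pos_sqr.
  by rewrite opprD -zz -zz'; exact: pos_mul_cadj_add.
have y0 : y * cadj y = 0.
  by apply: selfadj_sqr_eq0 => //; apply: posD_eq0 S0; exact: pos_sqr.
have k0 : k = 0.
  apply: selfadj_sqr_eq0 => //; apply: selfadj_sqr_eq0 => //.
  by move: S0; rewrite y0 mul0r add0r.
have g0 : g = 0.
  apply: selfadj_sqr_eq0 => //; apply: selfadj_sqr_eq0.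
    by rewrite cadjM gs.
  by rewrite mulrA -{1}mg mulrnAl mulrnAl -kk k0 mul0r mul0r mul0rn.
by rewrite -/h -(subrK h m) in pm *; rewrite -/g g0 add0r in pm.
Qed.

(** Suppose |b| < |a|.  From b <= |b| one gets that |b| - a is positive.
    Shifting it by |a| shows that c = (|a| - |b|) + a has norm at most |a|;
    since c is positive, shifting it by |a| / 2 gives
    |a| <= |a| / 2 + | |b| - |a| / 2 | < |a|. *)
Lemma pos_le_norm a b : pos a -> pos (b - a) -> `|a| <= `|b|.
Proof.
move=> pa pba.
have pb : pos b by rewrite -(subrK a b); exact: posD.
have [//|ba] := leP `|a| `|b|.
have [b0|b0] := eqVneq b 0.
  move: pba ba; rewrite b0 sub0r => /(pos_antisym pa) ->.
  by rewrite normr0 ltxx.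
have {}b0 : 0 < `|b| by rewrite normr_gt0.
have pba' : pos (`|b|%:B - a).
  rewrite -(subrKA b); apply: posD => //; apply: pos_norm_sub.
  by case: pb.
have /(pos_norm pba') H1 : `| `|b|%:B - a| <= 2 * `|a|.
  rewrite (le_trans (ler_normB _ _))// mulr2n mulrDl mul1r lerD//.
  by rewrite (le_trans (norm_cst _ _))// ltW.
(* c = |a| - (|b| - a), whose norm is at most |a| by H1. *)
pose c := (`|a| - `|b|)%:B + a.
have pc : pos c by apply: posD => //; apply: pos_cst; rewrite subr_ge0 ltW.
have /(pos_norm pc) H2 : `|c| <= 2 * (`|a| / 2).
  rewrite mulrCA divff// mulr1; move: H1.
  by rewrite opprB addrCA addrC /c scalerBl.
have cE : (`|a| / 2)%:B - c = (`|b| - `|a| / 2)%:B - a.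
  rewrite /c opprD addrA -scalerBl; congr (_ *: _ - _); by field.
have : `|a| <= `|a| / 2 + `| `|b| - `|a| / 2|.
  have {1}-> : `|a| = `|((`|a| / 2)%:B - c) - (`|b| - `|a| / 2)%:B|.
    by rewrite cE addrAC subrr add0r normrN.
  rewrite (le_trans (ler_normB _ _))// lerD// normrZ ler_piMr//.
  exact: normB1_le1.
move=> h2.
by have [h1|h1] := lerP 0 (`|b| - `|a| / 2); move: h2;
  rewrite ?(ger0_norm h1) ?(ltr0_norm h1) => h2; exfalso; lra.
Qed.

End Positivity.

(** * The norm of the standard module *)

Section StandardModuleNorm.
Variables (R : realType) (A : unitalCStarAlgType R).
Local Notation B := (realA A).
Local Notation seqA := (nat -> A).
Local Notation "t %:B" := (t *: (1 : B)) (at level 2, format "t %:B").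
Implicit Types (x y z : seqA) (t e : R).

Definition sq x (n : nat) : B := cadj (x n) * x n.
Definition seg x m n : B := \sum_(m <= k < n) sq x k.
(** Real scalars act through A, as complex scalars do. *)
Definition rsc t x : seqA := ract x t%:B.

Lemma rscE t x n : rsc t x n = t *: (x n : B).
Proof. by rewrite /rsc /ract -[LHS]rscalerAr mulr1. Qed.

Lemma sq_pos x n : pos (sq x n). Proof. exact: pos_cadj_mul. Qed.

Lemma pos0 : pos (0 : B).
Proof. by have := pos_cst A (lexx 0); rewrite scale0r. Qed.

Lemma seg_pos x m n : pos (seg x m n).
Proof.
by apply: (big_ind (@pos R A)) => *; [exact: pos0|exact: posD|exact: sq_pos].
Qed.

Lemma norm_sq x n : `|sq x n| = `|x n : B| ^+ 2. Proof. exact: norm_cadjM. Qed.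

(** The Hilbert module version of
    (x + y)^2 + (t x - y)^2 / t = (1 + t) x^2 + (1 + 1/t) y^2. *)
Lemma sq_add t x y n : 0 < t -> sq (x + y) n + t^-1 *: sq (rsc t x - y) n =
  (1 + t) *: sq x n + (1 + t^-1) *: sq y n.
Proof.
move=> t0; rewrite /sq -[(x + y) n]/((x n : B) + y n).
rewrite -[(rsc t x - y) n]/((rsc t x n : B) - y n) rscE.
move: (x n : B) (y n : B) => a b.
rewrite cadjB cadjD cadjZ mulrBl !mulrBr mulrDl !mulrDr !rscalerM.
rewrite -!rscalerAl -!rscalerAr !scalerBr !scalerA.
rewrite mulrA mulVf ?gt_eqF// mul1r scale1r opprB.
rewrite !scalerDl !scale1r.
rewrite [LHS](AC ((2*2)*(2*2)) (((1*5)*(4*7))*((2*6)*(3*8))))/=.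
by rewrite !subrr !addr0.
Qed.

(** For t = 1 this makes [HA] closed under addition; letting t be the ratio of
    the norms gives the triangle inequality. *)
Lemma norm_seg_add t x y m n : 0 < t ->
  `|seg (x + y) m n| <= (1 + t) * `|seg x m n| + (1 + t^-1) * `|seg y m n|.
Proof.
move=> t0; have ti0 : 0 < t^-1 by rewrite invr_gt0.
have E : seg (x + y) m n + t^-1 *: seg (rsc t x - y) m n =
    (1 + t) *: seg x m n + (1 + t^-1) *: seg y m n.
  rewrite /seg !scaler_sumr -!big_split/=; apply: eq_bigr => k _.
  exact: sq_add.
have : `|seg (x + y) m n| <= `|(1 + t) *: seg x m n + (1 + t^-1) *: seg y m n|.
  rewrite -E; apply: pos_le_norm; first exact: seg_pos.
  rewrite addrC addKr; apply: posZ; [exact: ltW|exact: seg_pos].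
move=> /le_trans; apply; rewrite (le_trans (ler_normD _ _))// !normrZ.
by rewrite !gtr0_norm// addr_gt0.
Qed.

Lemma seg_cat x m n p : (m <= n)%N -> (n <= p)%N ->
  seg x m p = seg x m n + seg x n p.
Proof. by move=> mn np; rewrite /seg (big_cat_nat mn np). Qed.

Lemma seg_le x m n p q : (p <= m)%N -> (m <= n)%N -> (n <= q)%N ->
  `|seg x m n| <= `|seg x p q|.
Proof.
move=> pm mn nq; apply: pos_le_norm; first exact: seg_pos.
rewrite (seg_cat x pm (leq_trans mn nq)) (seg_cat x mn nq).
rewrite addrCA addrAC addrN add0r; apply: posD; exact: seg_pos.
Qed.

Lemma HA_cvgP x : HA x <-> cvgn (fun n => seg x 0 n).
Proof.
split=> /cvg_ex[l xl]; apply/cvg_ex; exists l; exact/realA_cvgP.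
Qed.

Lemma HA_cauchyP x : HA x <-> forall e, 0 < e -> exists N : nat,
  forall m n, (N <= m)%N -> (m <= n)%N -> `|seg x m n| < e.
Proof.
rewrite HA_cvgP cvgn_cauchyP.
by split=> H e e0; have [N HN] := H e e0; exists N => m n Nm mn;
  have := HN m n Nm mn; rewrite (seg_cat x (leq0n m) mn) addrC addKr.
Qed.

Lemma HA_add x y : HA x -> HA y -> HA (x + y).
Proof.
move=> /HA_cauchyP Hx /HA_cauchyP Hy; apply/HA_cauchyP => e e0.
have e4 : 0 < e / 4 by rewrite divr_gt0.
have [N1 H1] := Hx _ e4; have [N2 H2] := Hy _ e4.
exists (maxn N1 N2) => m n; rewrite geq_max => /andP[N1m N2m] mn.
have := norm_seg_add x y m n ltr01; rewrite invr1 => /le_lt_trans; apply.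
by have := H1 m n N1m mn; have := H2 m n N2m mn; lra.
Qed.

Lemma HA_ract x a : HA x -> HA (ract x a).
Proof.
rewrite !HA_cvgP => /cvg_ex[l xl]; apply/cvg_ex.
exists (cadj a * l * a).
have E n : seg (ract x a) 0 n = cadj a * seg x 0 n * a.
  rewrite /seg mulr_sumr mulr_suml; apply: eq_bigr => k _.
  by rewrite /sq cadjM !mulrA.
under eq_fun do rewrite E.
apply: cvgB_M; last exact: cvg_cst.
by apply: cvgB_M => //; exact: cvg_cst.
Qed.

Lemma HA0 : HA (0 : seqA).
Proof.
apply/HA_cauchyP => e e0; exists 0%N => m n _ _.
by rewrite /seg big1 ?normr0// => k _; rewrite /sq mulr0.
Qed.

Lemma HA_rsc t x : HA x -> HA (rsc t x). Proof. exact: HA_ract. Qed.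

Lemma rscN1 x : rsc (-1) x = - x.
Proof. by apply/funext => n; rewrite rscE scaleN1r. Qed.

Lemma HA_opp x : HA x -> HA (- x).
Proof. by rewrite -rscN1; exact: HA_rsc. Qed.

Lemma HA_sub x y : HA x -> HA y -> HA (x - y).
Proof. by move=> Hx Hy; apply: HA_add => //; exact: HA_opp. Qed.

Definition gram x : B := inner x x.

Lemma cvg_gram x : HA x -> (fun n => seg x 0 n) @ \oo --> gram x.
Proof. by move=> Hx; exact/realA_cvgP. Qed.

Lemma cvg_norm_gram x :
  HA x -> (fun n => `|seg x 0 n|) @ \oo --> `|gram x|.
Proof. by move=> Hx; apply: cvg_norm; exact: cvg_gram. Qed.

Lemma normHE x : normH x = Num.sqrt `|gram x|. Proof. by []. Qed.

Lemma normH_ge0 x : 0 <= normH x. Proof. exact: sqrtr_ge0. Qed.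

Lemma normH_sqr x : normH x ^+ 2 = `|gram x|.
Proof. by rewrite normHE sqr_sqrtr. Qed.

Lemma normH_le x e : 0 <= e -> (normH x <= e) = (`|gram x| <= e ^+ 2).
Proof.
by move=> e0; rewrite -normH_sqr ler_pXn2r// nnegrE normH_ge0.
Qed.

Lemma norm_seg_gram x n : HA x -> `|seg x 0 n| <= `|gram x|.
Proof.
move=> Hx; have H := cvg_norm_gram Hx.
rewrite -(cvg_lim _ H)//; apply: limr_ge.
  by apply/cvg_ex; eexists; exact: H.
by exists n => // m /= nm; exact: seg_le.
Qed.

Lemma gram_le x (c : R) :
  HA x -> (forall n, `|seg x 0 n| <= c) -> `|gram x| <= c.
Proof.
move=> Hx xc; have H := cvg_norm_gram Hx.
rewrite -(cvg_lim _ H)//; apply: limr_le.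
  by apply/cvg_ex; eexists; exact: H.
exact: nearW.
Qed.

Lemma norm_coord x n : HA x -> `|x n : B| <= normH x.
Proof.
move=> Hx; rewrite -(@ler_pXn2r _ 2)// ?nnegrE ?normH_ge0// normH_sqr -norm_sq.
rewrite (le_trans _ (norm_seg_gram n.+1 Hx))//.
rewrite (le_trans _ (seg_le x (leq0n n) (leqnSn n) (leqnn n.+1)))//.
by rewrite /seg big_nat1.
Qed.

(** With a > normH x and b > normH y, the bound for t = b / a is
    (1 + b/a) a^2 + (1 + a/b) b^2 = (a + b)^2. *)
Lemma normH_triangle x y : HA x -> HA y -> normH (x + y) <= normH x + normH y.
Proof.
move=> Hx Hy; apply/ler_addgt0Pr => e e0.
pose a := normH x + e / 2; pose b := normH y + e / 2.
have a0 : 0 < a by have := normH_ge0 x; rewrite /a; lra.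
have b0 : 0 < b by have := normH_ge0 y; rewrite /b; lra.
have -> : normH x + normH y + e = a + b by rewrite /a /b; lra.
have Hxy := HA_add Hx Hy.
have xa : `|gram x| <= a ^+ 2.
  by rewrite -normH_sqr ler_pXn2r ?nnegrE ?normH_ge0// ?(ltW a0)// /a; lra.
have yb : `|gram y| <= b ^+ 2.
  by rewrite -normH_sqr ler_pXn2r ?nnegrE ?normH_ge0// ?(ltW b0)// /b; lra.
have t0 : 0 < b / a by rewrite divr_gt0.
rewrite (normH_le _ (ltW (addr_gt0 a0 b0))); apply: gram_le => // n.
rewrite (le_trans (norm_seg_add x y 0 n t0))//.
have -> : (a + b) ^+ 2 = (1 + b / a) * a ^+ 2 + (1 + (b / a)^-1) * b ^+ 2.
  by field; rewrite !gt_eqF.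
apply: lerD; rewrite ler_wpM2l//.
- by rewrite addr_ge0// ltW.
- by rewrite (le_trans (norm_seg_gram n Hx)).
- by rewrite addr_ge0// ltW// invr_gt0.
- by rewrite (le_trans (norm_seg_gram n Hy)).
Qed.

Lemma normH_rsc t x : HA x -> normH (rsc t x) = `|t| * normH x.
Proof.
move=> Hx; rewrite !normHE.
have -> : gram (rsc t x) = (t ^+ 2) *: gram x.
  have E n : seg (rsc t x) 0 n = (t ^+ 2) *: seg x 0 n.
    rewrite /seg scaler_sumr; apply: eq_bigr => k _.
    by rewrite /sq rscE cadjZ rscalerM expr2.
  have H1 := cvg_gram (@HA_rsc t _ Hx).
  have H2 : (fun n => seg (rsc t x) 0 n) @ \oo --> t ^+ 2 *: gram x.
    by under eq_fun do rewrite E; apply: cvgZl_tmp; exact: cvg_gram.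
  by apply: (cvg_unique _ H1) => //; exact: H2.
by rewrite normrZ ger0_norm ?sqr_ge0// sqrtrM ?sqr_ge0// sqrtr_sqr.
Qed.

Lemma normH_eq0 x : HA x -> normH x = 0 -> x = 0.
Proof.
move=> Hx x0; apply/funext => n; apply/(@normr0_eq0 _ B)/eqP.
by rewrite eq_le normr_ge0 andbT -x0 norm_coord.
Qed.

End StandardModuleNorm.

(** * The standard module as a Banach space *)

Section FilterCompleteness.
Variables (R : realType) (V : normedModType R).

(** A Cauchy filter contains balls of radius 1/(n+1); their centres form a
    Cauchy sequence, and the filter converges to its limit. *)
Lemma seq_complete_filter :
  (forall u : nat -> V, (forall e : R, 0 < e -> exists N : nat, forall n m,
     (N <= n)%N -> (n <= m)%N -> `|u m - u n| < e) -> cvgn u) ->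
  forall F : set_system V, ProperFilter F -> cauchy F -> cvg F.
Proof.
move=> VC F FF /cauchyP Fc.
have inv0 (n : nat) : 0 < n.+1%:R^-1 :> R by rewrite invr_gt0.
have /choice[u Fu] : forall n : nat, exists x : V, F (ball x n.+1%:R^-1).
  by move=> n; exact: Fc (inv0 n).
have uu n m : `|u m - u n| < m.+1%:R^-1 + n.+1%:R^-1.
  have [z []] := filter_ex (filterI (Fu m) (Fu n)).
  rewrite -!ball_normE/= => um un; rewrite -(subrKA z).
  by rewrite (le_lt_trans (ler_normD _ _))// ltrD// distrC.
have small (e : R) : 0 < e ->
    exists N : nat, forall n, (N <= n)%N -> n.+1%:R^-1 < e.
  move=> e0; exists (Num.truncn e^-1) => n Nn.
  rewrite invf_plt ?posrE ?ltr0n//.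
  by rewrite (lt_le_trans (truncnS_gt _))// ler_nat.
have /VC/cvg_ex[l ul] : forall e : R, 0 < e -> exists N : nat, forall n m,
    (N <= n)%N -> (n <= m)%N -> `|u m - u n| < e.
  move=> e e0; have e2 : 0 < e / 2 by rewrite divr_gt0.
  have [N HN] := small _ e2; exists N => n m Nn nm.
  rewrite (lt_trans (uu n m))// [e]splitr ltrD ?HN//.
  exact: leq_trans nm.
apply/cvg_ex; exists l; apply/cvgrPdist_lt => e e0.
have e2 : 0 < e / 2 by rewrite divr_gt0.
have [N HN] := small _ e2.
move/cvgrPdist_lt : ul => /(_ _ e2)[M _ HM].
have := Fu (maxn N M); apply: filterS => x; rewrite -ball_normE/= => ux.
rewrite -(subrKA (u (maxn N M))) (le_lt_trans (ler_normD _ _))//.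
rewrite [e]splitr ltrD//; first by apply: HM => /=; exact: leq_maxr.
by rewrite (lt_trans ux)// HN// leq_maxl.
Qed.

End FilterCompleteness.

Section StandardModuleSpace.
Variables (R : realType) (A : unitalCStarAlgType R).
Local Notation B := (realA A).
Local Notation seqA := (nat -> A).

Record HAspace := MkHA { hval : seqA; hvalP : HA hval }.

Arguments hvalP : clear implicits.

Lemma hval_inj : injective hval.
Proof.
by move=> [x Hx] [y Hy] /= xy; subst y; congr MkHA; exact: Prop_irrelevance.
Qed.

HB.instance Definition _ := gen_eqMixin HAspace.
HB.instance Definition _ := gen_choiceMixin HAspace.

Definition hzero := MkHA (@HA0 R A).
Definition hadd (x y : HAspace) := MkHA (HA_add (hvalP x) (hvalP y)).
Definition hopp (x : HAspace) := MkHA (HA_opp (hvalP x)).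
Definition hscale (t : R) (x : HAspace) := MkHA (@HA_rsc _ _ t _ (hvalP x)).

Lemma haddA : associative hadd.
Proof. by move=> x y z; apply: hval_inj; exact: addrA. Qed.
Lemma haddC : commutative hadd.
Proof. by move=> x y; apply: hval_inj; exact: addrC. Qed.
Lemma hadd0 : left_id hzero hadd.
Proof. by move=> x; apply: hval_inj; exact: add0r. Qed.
Lemma haddN : left_inverse hzero hopp hadd.
Proof. by move=> x; apply: hval_inj; exact: addNr. Qed.

HB.instance Definition _ :=
  GRing.isZmodule.Build HAspace haddA haddC hadd0 haddN.

Lemma hscaleA s t x : hscale s (hscale t x) = hscale (s * t) x.
Proof.
by apply: hval_inj; apply/funext => n; rewrite /= !rscE scalerA.
Qed.
Lemma hscale1 : left_id 1 hscale.
Proof.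
by move=> x; apply: hval_inj; apply/funext => n; rewrite /= rscE scale1r.
Qed.
Lemma hscaleDr : right_distributive hscale +%R.
Proof.
move=> t x y; apply: hval_inj; apply/funext => n /=.
rewrite rscE; transitivity (t *: (hval x n : B) + t *: (hval y n : B)).
  exact: scalerDr.
by rewrite -!rscE.
Qed.
Lemma hscaleDl x : {morph hscale^~ x : s t / s + t}.
Proof.
move=> s t; apply: hval_inj; apply/funext => n /=.
rewrite rscE; transitivity (s *: (hval x n : B) + t *: (hval x n : B)).
  exact: (scalerDl (hval x n : B) s t).
by rewrite -!rscE.
Qed.

HB.instance Definition _ :=
  GRing.Zmodule_isLmodule.Build R HAspace hscaleA hscale1 hscaleDr hscaleDl.

Definition hnorm (x : HAspace) : R := normH (hval x).

Lemma hnormD x y : hnorm (x + y) <= hnorm x + hnorm y.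
Proof. by apply: normH_triangle; exact: hvalP. Qed.
Lemma hnormZ t x : hnorm (t *: x) = `|t| * hnorm x.
Proof. by apply: normH_rsc; exact: hvalP. Qed.
Lemma hnorm_eq0 x : hnorm x = 0 -> x = 0.
Proof.
by move=> x0; apply: hval_inj; apply: normH_eq0 => //; exact: hvalP.
Qed.

HB.instance Definition _ :=
  @Lmodule_isNormed.Build R HAspace hnorm hnormD hnormZ hnorm_eq0.

(** The limit is taken coordinatewise.  A bound for the finite sums of u_j - u_i
    passes to j -> oo, because finite sums only involve finitely many
    coordinates; this bound first shows that the limit lies in [HA], and then
    that the convergence holds in norm. *)
Lemma HAspace_seq_complete (u : nat -> HAspace) :
  (forall e : R, 0 < e -> exists N : nat, forall n m,
     (N <= n)%N -> (n <= m)%N -> `|u m - u n| < e) -> cvgn u.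
Proof.
move=> uC.
have coordC k : cvgn (fun n => hval (u n) k : B).
  apply/cvgn_cauchyP => e e0; have [N HN] := uC e e0; exists N => n m Nn nm.
  apply: le_lt_trans (HN n m Nn nm).
  exact: norm_coord (hvalP (u m - u n)).
pose x : seqA := fun k => limn (fun n => hval (u n) k : B).
have coord k : (fun n => hval (u n) k : B) @ \oo --> (x k : B) by exact: coordC.
have seg_lim i m : (fun j => seg (hval (u j) - hval (u i)) 0 m) @ \oo -->
    seg (x - hval (u i)) 0 m.
  elim: m => [|m IH].
    rewrite /seg big_nil; under eq_fun do rewrite big_nil.
    exact: cvg_cst.
  have E z : seg z 0 m.+1 = seg z 0 m + sq z m by rewrite /seg big_nat_recr.
  rewrite E; under eq_fun do rewrite E.
  have cm : (fun j => (hval (u j) - hval (u i)) m : B) @ \oo -->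
      ((x - hval (u i)) m : B).
    by apply: (@cvgB _ B) => //; exact: cvg_cst.
  by apply: cvgD => //; apply: cvgB_M => //; exact: cvg_cadj.
have seg_bd (e : R) : 0 < e -> exists N : nat, forall i m, (N <= i)%N ->
    `|seg (x - hval (u i)) 0 m| <= e ^+ 2.
  move=> e0; have [N HN] := uC e e0; exists N => i m Ni.
  have H : (fun j => `|seg (hval (u j) - hval (u i)) 0 m|) @ \oo -->
      `|seg (x - hval (u i)) 0 m| by apply: cvg_norm; exact: seg_lim.
  rewrite -(cvg_lim _ H)//; apply: limr_le.
    by apply/cvg_ex; eexists; exact: H.
  exists i => // j /= ij.
  rewrite (le_trans (norm_seg_gram m (hvalP (u j - u i))))//.
  rewrite -normH_sqr ler_pXn2r// ?nnegrE ?normH_ge0 ?(ltW e0)//.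
  by apply: ltW; exact: HN.
have Hx : HA x.
  apply/HA_cauchyP => e e0.
  (* d^2 = e/8 and the tail bound e/8 leave 2 (e/8 + e/8) = e/2 < e. *)
  pose d := Num.sqrt (e / 8).
  have d0 : 0 < d by rewrite sqrtr_gt0 divr_gt0.
  have dd : d ^+ 2 = e / 8 by rewrite sqr_sqrtr// ltW// divr_gt0.
  have [N HN] := seg_bd d d0.
  have /HA_cauchyP/(_ _ (divr_gt0 e0 (ltr0n R 8)))[M HM] := hvalP (u N).
  exists M => m n Mm mn.
  have -> : x = (x - hval (u N)) + hval (u N) by rewrite subrK.
  apply: le_lt_trans (norm_seg_add _ _ _ _ ltr01) _.
  have h1 := le_trans (seg_le _ (leq0n m) mn (leqnn n)) (HN N n (leqnn N)).
  have h2 := HM m n Mm mn.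
  by rewrite invr1; rewrite dd in h1; lra.
apply/cvg_ex; exists (MkHA Hx); apply/cvgrPdist_le => e e0.
have [N HN] := seg_bd e e0; exists N => // i /= Ni.
rewrite -[leLHS]/(normH (x - hval (u i))) normH_le ?(ltW e0)//.
apply: gram_le => [|m]; last exact: HN.
by apply: HA_sub => //; exact: hvalP.
Qed.

HB.instance Definition _ := Uniform_isComplete.Build HAspace
  (seq_complete_filter HAspace_seq_complete).

End StandardModuleSpace.
Arguments hvalP {R A} h : rename.

(** * Complements in Banach spaces *)

Section BanachComplements.
Variables (R : realType) (V : completeNormedModType R).
Implicit Types (M N : set V) (T S : V -> V) (x y m n : V) (C K : R).

Definition closed_subspace M := [/\ M 0, forall x y, M x -> M y -> M (x + y),
  forall (t : R) x, M x -> M (t *: x) & closed M].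

Lemma closed_subspaceB M x y : closed_subspace M -> M x -> M y -> M (x - y).
Proof.
move=> [_ MD MZ _] Mx My; apply: MD => //; rewrite -scaleN1r; exact: MZ.
Qed.

(** If every y can be approximated within |y| / 2 by some T m + n with m of size
    at most C |y|, then correcting the error again and again produces an exact
    solution; the geometric series costs a factor 2.  The convergence of the
    N-parts is not assumed: it follows from that of the M-parts. *)
Lemma successive_approximation M N T C K :
  closed_subspace M -> closed_subspace N ->
  (forall x y, M x -> M y -> T (x - y) = T x - T y) ->
  (forall x, M x -> `|T x| <= K * `|x|) -> 0 <= C ->
  (forall y, exists m n, [/\ M m, N n, `|m| <= C * `|y| &
    `|y - (T m + n)| <= `|y| / 2]) ->
  forall y, exists m n, [/\ M m, N n, y = T m + n & `|m| <= 2 * C * `|y|].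
Proof.
move=> sM sN TB TK C0 approx y.
have [M0 MD MZ Mcl] := sM; have [N0 ND NZ Ncl] := sN.
have /choice[f /choice[g fg]] := approx.
pose r := fix r k : V := if k is j.+1 then r j - (T (f (r j)) + g (r j)) else y.
pose P := fix P k : V := if k is j.+1 then P j + f (r j) else 0.
have rS k : r k.+1 = r k - (T (f (r k)) + g (r k)) by [].
have PS k : P k.+1 = P k + f (r k) by [].
have Mf k : M (f (r k)) by have [] := fg (r k).
have MP k : M (P k) by elim: k => // k IH; rewrite PS; exact: MD.
have T0 : T 0 = 0 by rewrite -[in LHS](subrr 0) TB// subrr.
have TD u v : M u -> M v -> T (u + v) = T u + T v.
  move=> Mu Mv; have MNv : M (- v) by rewrite -sub0r; exact: closed_subspaceB.
  by rewrite -[in LHS](opprK v) TB// -(sub0r v) TB// T0 sub0r opprK.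
have rk k : `|r k| <= `|y| * 2^-1 ^+ k.
  elim: k => [|k IH]; first by rewrite expr0 mulr1.
  have [_ _ _ H] := fg (r k); rewrite rS (le_trans H)// exprSr mulrA.
  by rewrite ler_wpM2r.
pose s k : R := 2 * C * `|y| * (1 - 2^-1 ^+ k).
have geo : (fun k : nat => 2^-1 ^+ k : R) @ \oo --> (0 : R).
  by apply: cvg_expr; rewrite ger0_norm// invf_lt1// ltr1n.
have sP k : `|P k.+1 - P k| <= s k.+1 - s k.
  rewrite PS addrC addKr; have [_ _ H _] := fg (r k).
  rewrite (le_trans H)//; have -> : s k.+1 - s k = C * (`|y| * 2^-1 ^+ k).
    by rewrite /s exprSr; field.
  by rewrite ler_wpM2l.
have sc : cvgn s.
  apply: is_cvgMr; apply: is_cvgB; first exact: is_cvg_cst.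
  by apply/cvg_ex; exists 0.
have Ps k : `|P k| <= s k.
  elim: k => [|k IH]; first by rewrite /s expr0 subrr mulr0 normr0.
  rewrite -(subrK (P k) (P k.+1)) (le_trans (ler_normD _ _))//.
  by have := sP k; move: IH; lra.
have Pbd k : `|P k| <= 2 * C * `|y|.
  have c0 : 0 <= 2 * C * `|y| by rewrite !mulr_ge0.
  rewrite (le_trans (Ps k))// /s (ler_piMr c0)//.
have /cvg_ex[p Pp] := cvgn_dominated sc sP.
have Mp : M p by apply: closed_cvg Pp => //; exact: nearW.
(* The k-th partial sum of the N-parts. *)
have NQ k : N (y - r k - T (P k)).
  elim: k => [|k IH]; first by rewrite /= T0 subrr subr0.
  rewrite PS TD// rS; have [_ Ng _ _] := fg (r k).
  have -> : y - (r k - (T (f (r k)) + g (r k))) - (T (P k) + T (f (r k))) =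
      (y - r k - T (P k)) + g (r k); last exact: ND.
    rewrite opprB opprD [LHS](AC ((1*(2*1))*2) ((1*4*5*3)*(2*6)))/=.
    by rewrite subrr addr0.
exists p, (y - T p); split=> //; last 2 first.
- by rewrite addrC subrK.
- have H : (fun k => `|P k|) @ \oo --> `|p| by exact: cvg_norm.
  rewrite -(cvg_lim _ H)//; apply: limr_le; first by apply/cvg_ex; exists `|p|.
  exact: nearW.
have TP : (fun k => T (P k)) @ \oo --> T p.
  apply/subr_cvg0; apply: norm_cvg0.
  apply: (squeeze_cvgr (f := cst 0) (h := fun k => K * `|P k - p|)).
  - apply: nearW => k /=; rewrite normr_ge0/= -TB//; apply: TK.
    exact: closed_subspaceB.
  - exact: cvg_cst.
  - rewrite -[X in _ --> X](mulr0 K); apply: cvgM; first exact: cvg_cst.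
    by rewrite -(normr0 V); apply: cvg_norm; apply/subr_cvg0.
have r0 : r @ \oo --> (0 : V).
  apply: norm_cvg0.
  apply: (squeeze_cvgr (f := cst 0) (h := fun k => `|y| * 2^-1 ^+ k)).
  - by apply: nearW => k /=; rewrite normr_ge0/=.
  - exact: cvg_cst.
  - rewrite -[X in _ --> X](mulr0 `|y|); apply: cvgM => //; exact: cvg_cst.
have yTp : (fun k => y - r k - T (P k)) @ \oo --> y - T p.
  rewrite -[X in X - T p](subr0 y).
  apply: cvgB => //; apply: cvgB => //; exact: cvg_cst.
by apply: closed_cvg yTp => //; exact: nearW.
Qed.

(** The open mapping theorem for M x N -> V.  The sets E_k of the x whose M-part
    has norm at most k cover V, so by Baire's theorem some closure contains a
    ball.  Differences of its points show that every y is approximated within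
    |y| / 2 by elements with M-part of size O(|y|), and
    [successive_approximation] removes the error. *)
Lemma complement_bound M N : closed_subspace M -> closed_subspace N ->
  (forall x, exists m n, [/\ M m, N n & x = m + n]) ->
  (forall x, M x -> N x -> x = 0) ->
  exists2 C, 0 <= C & forall m n, M m -> N n -> `|m| <= C * `|m + n|.
Proof.
move=> sM sN MN MN0; have [M0 MD MZ Mcl] := sM; have [N0 ND NZ Ncl] := sN.
suff [C C0 HC] : exists2 C, 0 <= C & forall y, exists m n,
    [/\ M m, N n, `|m| <= C * `|y| & `|y - (m + n)| <= `|y| / 2].
  exists (2 * C) => [|m n Mm Nn]; first by rewrite mulr_ge0.
  have [] := @successive_approximation M N id C 1 sM sN _ _ C0 HC (m + n).
  - by [].
  - by move=> x _; rewrite mul1r.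
  move=> m' [n' [Mm' Nn' mn mb]].
  suff mm' : m = m' by rewrite {1}mm'.
  apply/eqP; rewrite -subr_eq0; apply/eqP; apply: MN0.
    exact: closed_subspaceB.
  have -> : m - m' = n' - n.
    by apply/eqP; rewrite subr_eq addrAC eq_sym subr_eq addrC -mn addrC.
  exact: closed_subspaceB.
pose E (k : nat) :=
  [set x | exists m n, [/\ M m, N n, x = m + n & `|m| <= k%:R]].
have [k [x0 [r r0 Er]]] : exists k x0, exists2 r : R, 0 < r &
    ball x0 r `<=` closure (E k).
  pose O k := ~` closure (E k).
  have [k Ok] : exists k, ~ dense (O k).
    apply: contrapT => /forallNP H.
    have /Baire : forall k, open (O k) /\ dense (O k).
      move=> k; split; last by apply: contrapT; exact: H.
      by apply: closed_openC; exact: closed_closure.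
    move=> /(_ setT (ex_intro _ 0 I) openT)[x [_ Ox]].
    have [m [n [Mm Nn xmn]]] := MN x.
    apply: (Ox (Num.truncn `|m|).+1 I); apply: subset_closure.
    by exists m, n; split=> //; rewrite ltW// truncnS_gt.
  have [U [[x0 Ux0] UO]] := denseNE Ok.
  have [r /= r0 rU] := (iffLR (nbhs_ballP _ _) (open_nbhs_nbhs Ux0)).
  exists k, x0, r => // z /rU Uz; apply: contrapT => nz.
  by have : (U `&` O k) z by []; rewrite UO.
exists (4 * k%:R / r) => [|y].
  by rewrite divr_ge0 ?mulr_ge0// ltW.
have [->|y0] := eqVneq y 0.
  by exists 0, 0; split; rewrite // normr0 ?mulr0// addr0 subrr normr0 mul0r.
have ny0 : 0 < `|y| by rewrite normr_gt0.
(* The scaling brings x0 + s y into the ball around x0: |s y| = r / 2. *)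
pose s := r / (2 * `|y|).
have s0 : 0 < s by rewrite divr_gt0// mulr_gt0.
have r8 : 0 < r / 8 by rewrite divr_gt0.
have near_E z : ball x0 r z -> exists2 a, E k a & `|z - a| < r / 8.
  move=> /Er /(_ _ (nbhsx_ballx _ _ r8))[a [Ea]].
  by rewrite -ball_normE; exists a.
have [a [ma [na [Mma Nna aE mak]]] za] :
    exists2 a, E k a & `|x0 + s *: y - a| < r / 8.
  apply: near_E; rewrite -ball_normE/= opprD addrA subrr sub0r normrN normrZ.
  rewrite gtr0_norm//; have -> : s * `|y| = r / 2.
    by rewrite /s; field; rewrite gt_eqF.
  by rewrite ltr_pdivrMr// ltr_pMr// ltr1n.
have [b [mb [nb [Mmb Nnb bE mbk]]] zb] : exists2 b, E k b & `|x0 - b| < r / 8.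
  by apply: near_E; exact: ballxx.
exists (s^-1 *: (ma - mb)), (s^-1 *: (na - nb)); split.
- by apply: MZ; exact: closed_subspaceB.
- by apply: NZ; exact: closed_subspaceB.
- rewrite normrZ gtr0_norm ?invr_gt0//.
  have -> : 4 * k%:R / r * `|y| = s^-1 * (k%:R + k%:R).
    by rewrite /s; field; rewrite !gt_eqF.
  rewrite ler_wpM2l ?invr_ge0 ?(ltW s0)//.
  by rewrite (le_trans (ler_normB _ _))// lerD.
- rewrite -(ler_pM2l s0) -{1}(gtr0_norm s0) -normrZ -scalerDr scalerBr scalerA.
  rewrite divff ?gt_eqF// scale1r.
  have -> : ma - mb + (na - nb) = a - b by rewrite aE bE opprD addrACA.
  have -> : s *: y - (a - b) = (x0 + s *: y - a) - (x0 - b).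
    rewrite !opprB [RHS](AC (3*2) ((2*(4*3))*(1*5)))/=.
    by rewrite subrr addr0.
  rewrite (le_trans (ler_normB _ _))//.
  have -> : s * (`|y| / 2) = r / 4 by rewrite /s; field; rewrite gt_eqF.
  by lra.
Qed.

(** The solution of y = T m + n solves y = S m + n up to an error
    e |m| <= e C |y| <= |y| / 2, so [successive_approximation] applies.  The
    bound for S absorbs the same error. *)
Lemma perturbed_splitting M N T S C e :
  closed_subspace M -> closed_subspace N ->
  (forall x y, M x -> M y -> S (x - y) = S x - S y) ->
  0 <= C -> C * e <= 1 / 2 -> 0 <= e -> forall K,
  (forall x, M x -> `|T x| <= K * `|x|) ->
  (forall x, M x -> `|S x - T x| <= e * `|x|) ->
  (forall y, exists m n, [/\ M m, N n & y = T m + n]) ->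
  (forall m n, M m -> N n -> `|m| <= C * `|T m + n|) ->
  (forall y, exists m n, [/\ M m, N n & y = S m + n]) /\
  (forall m n, M m -> N n -> `|m| <= 2 * C * `|S m + n|).
Proof.
move=> sM sN SB C0 Ce e0 K TK ST TMN TC; split=> [y|m n Mm Nn].
- have [] := @successive_approximation M N S C (K + e) sM sN SB _ C0 _ y.
  + move=> x Mx; rewrite -(subrK (T x) (S x)) (le_trans (ler_normD _ _))//.
    by have := TK x Mx; have := ST x Mx; lra.
  + move=> z; have [m [n [Mm Nn zE]]] := TMN z.
    have mz : `|m| <= C * `|z| by rewrite zE TC.
    exists m, n; split=> //.
    have -> : z - (S m + n) = - (S m - T m).
      by rewrite zE opprD addrACA subrr addr0 opprB.
    rewrite normrN (le_trans (ST m Mm))//.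
    have : e * `|m| <= e * (C * `|z|) by rewrite ler_wpM2l.
    by have := normr_ge0 z; move: Ce; nra.
  + by move=> m [n [Mm Nn yE _]]; exists m, n.
- have : `|T m + n| <= `|S m + n| + e * `|m|.
    have -> : T m + n = (S m + n) - (S m - T m).
      by rewrite opprB [RHS](AC (2*2) ((3*2)*(1*4)))/= subrr addr0.
    by rewrite (le_trans (ler_normB _ _))// lerD// ST.
  have := TC m n Mm Nn; have := normr_ge0 m; have := normr_ge0 (S m + n).
  have : C * e * `|m| <= 1 / 2 * `|m| by rewrite ler_wpM2r.
  by move: Ce C0; nra.
Qed.

End BanachComplements.

(** * Submodules of the standard module *)

Section Submodules.
Variables (R : realType) (A : unitalCStarAlgType R).
Local Notation seqA := (nat -> A).
Implicit Types (M N L : set seqA) (x y z : seqA) (u v p : seqA -> seqA).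

Lemma ractN1 x : ract x (-1) = - x.
Proof. by apply/funext => n; rewrite /ract mulrN1. Qed.

Lemma ract1 x : ract x 1 = x.
Proof. by apply/funext => n; rewrite /ract mulr1. Qed.

Lemma normH0 : normH (0 : seqA) = 0.
Proof. exact: (normr0 (HAspace A)). Qed.

Lemma normHB x y : HA x -> HA y -> normH (x - y) <= normH x + normH y.
Proof. by move=> Hx Hy; exact: (ler_normB (MkHA Hx) (MkHA Hy)). Qed.

Section ClosedSubmodule.
Variables (M : set seqA).
Hypothesis sM : closed_submodule M.

Lemma submod_HA x : M x -> HA x. Proof. by case: sM => + _ _ _ _; exact. Qed.
Lemma submod0 : M 0. Proof. by case: sM. Qed.
Lemma submodD x y : M x -> M y -> M (x + y).
Proof. by case: sM => _ _ + _ _; exact. Qed.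
Lemma submod_ract x a : M x -> M (ract x a).
Proof. by case: sM => _ _ _ + _; exact. Qed.
Lemma submodN x : M x -> M (- x).
Proof. by rewrite -ractN1; exact: submod_ract. Qed.
Lemma submodB x y : M x -> M y -> M (x - y).
Proof. by move=> Mx My; apply: submodD => //; exact: submodN. Qed.
Lemma submod_closed : closed_in_HA M. Proof. by case: sM. Qed.

Lemma submod_closed_subspace : closed_subspace [set x : HAspace A | M (hval x)].
Proof.
split=> [|x y|t x|]; [exact: submod0|exact: submodD|exact: submod_ract|].
move=> x clx; apply: submod_closed; first exact: hvalP.
move=> e e0; have [y [My]] := clx _ (nbhsx_ballx x e e0).
by rewrite -ball_normE => xy; exists (hval y).
Qed.

Variable u : seqA -> seqA.
Hypothesis lu : linear_on M u.

Lemma linear_onD x y : M x -> M y -> u (x + y) = u x + u y.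
Proof. by move=> Mx My; have := lu 1 Mx My; rewrite !ract1. Qed.

Lemma linear_on0 : u 0 = 0.
Proof.
have := linear_onD submod0 submod0; rewrite addr0 => /esym/eqP.
by rewrite -subr_eq0 addrK => /eqP.
Qed.

Lemma linear_on_ract x a : M x -> u (ract x a) = ract (u x) a.
Proof.
by move=> Mx; have := lu a submod0 Mx; rewrite linear_on0 !add0r.
Qed.

Lemma linear_onN x : M x -> u (- x) = - u x.
Proof. by move=> Mx; rewrite -!ractN1 linear_on_ract. Qed.

Lemma linear_onB x y : M x -> M y -> u (x - y) = u x - u y.
Proof.
by move=> Mx My; rewrite linear_onD ?linear_onN//; exact: submodN.
Qed.

End ClosedSubmodule.

(** The constant of [bounded_on] may be negative when M is zero. *)
Lemma bounded_on_ge0 M u : bounded_on M u ->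
  exists2 c : R, 0 <= c & forall x, M x -> normH (u x) <= c * normH x.
Proof.
move=> [c uc]; exists (Num.max 0 c) => [|x Mx]; first by rewrite le_max lexx.
by rewrite (le_trans (uc x Mx))// ler_wpM2r ?normH_ge0// le_max lexx orbT.
Qed.

Lemma HA_submodule : closed_submodule (@HA R A).
Proof.
by split=> // *; [exact: HA0|exact: HA_add|exact: HA_ract].
Qed.

Lemma direct_sum_sym M N : direct_sum M N -> direct_sum N M.
Proof.
move=> [sM sN HE MN]; split=> //; last by rewrite setIC.
rewrite HE; apply/seteqP; split=> _ [x Mx [y Ny <-]];
  by exists y => //; exists x => //; rewrite addrC.
Qed.

Lemma direct_sum_bound M N : direct_sum M N ->
  exists2 C : R, 0 <= C &
    forall m n, M m -> N n -> normH m <= C * normH (m + n).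
Proof.
move=> [sM sN HE MN].
have [|x Mx Nx|C C0 HC] := complement_bound (submod_closed_subspace sM)
    (submod_closed_subspace sN).
- move=> x; have : HA (hval x) by exact: hvalP.
  rewrite HE => -[m Mm [n Nn mn]].
  exists (MkHA (submod_HA sM Mm)), (MkHA (submod_HA sN Nn)); split=> //.
  exact: hval_inj.
- apply: hval_inj; have : (M `&` N) (hval x) by [].
  by rewrite MN.
- exists C => // m n Mm Nn.
  exact: (HC (MkHA (submod_HA sM Mm)) (MkHA (submod_HA sN Nn))).
Qed.

Lemma direct_sum_unique M N m n m' n' : direct_sum M N ->
  M m -> N n -> M m' -> N n' -> m + n = m' + n' -> n = n'.
Proof.
move=> [sM sN HE MN] Mm Nn Mm' Nn' mn.
have E : n - n' = m' - m.
  by apply/eqP; rewrite subr_eq addrAC -mn [m + n]addrC addrK.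
have : (M `&` N) (n - n').
  by split; [rewrite E; exact: submodB|exact: submodB].
by rewrite MN => /eqP; rewrite subr_eq0 => /eqP.
Qed.

Lemma direct_sum_proj M N : direct_sum M N ->
  exists p, forall x, HA x -> N (p x) /\ M (x - p x).
Proof.
move=> [sM sN HE MN].
have : forall x, exists y, HA x -> N y /\ M (x - y).
  move=> x; have [Hx|nHx] := pselect (HA x); last by exists 0.
  have := Hx; rewrite HE => -[m Mm [n Nn <-]].
  by exists n => _; rewrite addrK.
by move=> /choice[p]; exists p.
Qed.

(** The isomorphism is the projection onto N' along M, restricted to N; its
    inverse is the projection onto N along M, and both are bounded by
    [direct_sum_bound]. *)
Lemma complements_iso M N N' : direct_sum M N -> direct_sum M N' ->
  exists p, module_iso N N' p.
Proof.
move=> dN dN'; have [p pN'] := direct_sum_proj dN'.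
have [sM sN _ _] := dN; have [_ sN' _ _] := dN'.
have pP x : HA x -> x = (x - p x) + p x by rewrite subrK.
have pN x : N x -> N' (p x) /\ M (x - p x).
  by move=> Nx; apply: pN'; exact: submod_HA Nx.
have pU x m n' : N x -> M m -> N' n' -> x = m + n' -> p x = n'.
  move=> Nx Mm Nn' E; have [h1 h2] := pN x Nx.
  by apply: (direct_sum_unique dN' h2 h1 Mm Nn'); rewrite subrK.
exists p; split.
- move=> x y a Nx Ny; have [px mx] := pN x Nx; have [py my] := pN y Ny.
  apply: (pU _ ((x - p x) + ract (y - p y) a)).
  + by apply: submodD => //; exact: submod_ract.
  + by apply: submodD => //; exact: submod_ract.
  + by apply: submodD => //; exact: submod_ract.
  + have -> : ract (y - p y) a = ract y a - ract (p y) a.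
      by apply/funext => n; rewrite /ract -[RHS]mulrBl.
    by rewrite addrACA !subrK.
- split.
  + by move=> x /pN[].
  + move=> x y /set_mem Nx /set_mem Ny pxy.
    have [px mx] := pN x Nx; have [py my] := pN y Ny.
    apply: (direct_sum_unique dN (m := - (x - p x)) (m' := - (y - p y))) => //;
      try exact: submodN.
    by rewrite !opprB !subrK.
  + move=> n' Nn'; have [q qN] := direct_sum_proj dN.
    have [h1 h2] := qN n' (submod_HA sN' Nn').
    exists (q n') => //; apply: (pU _ (- (n' - q n'))) => //.
      exact: submodN.
    by rewrite opprB subrK.
- have [C C0 HC] := direct_sum_bound (direct_sum_sym dN').
  exists C => x Nx; have [px mx] := pN x Nx.
  by have := HC _ _ px mx; rewrite addrCA subrr addr0.
- have [C C0 HC] := direct_sum_bound (direct_sum_sym dN).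
  exists C => x Nx; have [px mx] := pN x Nx.
  by have := HC _ _ Nx (submodN sM mx); rewrite opprB addrCA subrr addr0.
Qed.

Lemma module_iso_comp L M N u v : module_iso L M u -> module_iso M N v ->
  module_iso L N (v \o u).
Proof.
move=> [lu bu [c uc] [d ud]] [lv bv /bounded_on_ge0[c' c'0 vc'] [d' vd']].
have uM x : L x -> M (u x) by case: bu => + _ _; exact.
split.
- by move=> x y a Lx Ly /=; rewrite lu// lv//; exact: uM.
- exact: set_bij_comp bv.
- exists (c' * c) => x Lx /=.
  by rewrite (le_trans (vc' _ (uM x Lx)))// -mulrA ler_wpM2l// uc.
- exists (Num.max 0 d * d') => x Lx /=.
  rewrite (le_trans (ud x Lx))//.
  rewrite (@le_trans _ _ (Num.max 0 d * normH (u x)))//.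
    by rewrite ler_wpM2r ?normH_ge0// le_max lexx orbT.
  by rewrite -mulrA ler_wpM2l ?le_max ?lexx// vd'//; exact: uM.
Qed.

Lemma finitely_generated_iso N N' p : closed_submodule N ->
  module_iso N N' p -> finitely_generated N -> finitely_generated N'.
Proof.
move=> sN [lp [pN' _ pS] _ _] [k [g NE]]; exists k, (p \o g).
have Ng i : N (g i).
  rewrite NE; exists (fun j => if j == i then 1 else 0).
  rewrite (bigD1 i)//= eqxx ract1 big1 ?addr0// => j /negbTE ->.
  by apply/funext => n; rewrite /ract mulr0.
have H (a : 'I_k -> A) : N (\sum_(i < k) ract (g i) (a i)) /\
    p (\sum_(i < k) ract (g i) (a i)) = \sum_(i < k) ract ((p \o g) i) (a i).
  elim/big_rec2: _ => [|i y x _ [Nx <-]].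
    by split; [exact: submod0|exact: (linear_on0 sN lp)].
  have Nga := submod_ract sN (a i) (Ng i).
  split; first exact: submodD.
  by rewrite (linear_onD lp)// (linear_on_ract sN lp).
apply/seteqP; split=> [y /pS[x Nx <-]|_ [a ->]].
  move: Nx; rewrite NE => -[a ->]; exists a; exact: (H a).2.
by rewrite -(H a).2; apply: pN'; exact: (H a).1.
Qed.

(** Closedness of the image holds because p is bounded below: a limit of points
    p z_k lies in M', hence is p x for some x in M, and the z_k converge to
    x. *)
Lemma module_iso_image M M' L p : closed_submodule M -> closed_submodule M' ->
  module_iso M M' p -> closed_submodule L -> L `<=` M ->
  closed_submodule (p @` L) /\ module_iso L (p @` L) p.
Proof.
move=> sM sM' [lp [pM' pI pS] [c pc] [d pd]] sL LM; split; last first.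
  split.
  - by move=> x y a /LM Mx /LM My; exact: lp.
  - split=> [x Lx|x y /set_mem/LM Mx /set_mem/LM My|//].
      by exists x.
    by apply: pI; rewrite inE.
  - by exists c => x /LM; exact: pc.
  - by exists d => x /LM; exact: pd.
have HM x : M x -> HA (p x) by move=> Mx; apply: submod_HA sM' _ _; exact: pM'.
split.
- by move=> _ [x Lx <-]; exact: HM (LM x Lx).
- by exists 0; [exact: submod0|exact: (linear_on0 sM lp)].
- move=> _ _ [x Lx <-] [y Ly <-]; exists (x + y); first exact: submodD.
  by rewrite (linear_onD lp)//; exact: LM.
- move=> _ a [x Lx <-]; exists (ract x a); first exact: submod_ract.
  by rewrite (linear_on_ract sM lp)//; exact: LM.
move=> y Hy yL.
have M'y : M' y.
  apply: (submod_closed sM') => // e e0; have [_ [x Lx <-] yx] := yL e e0.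
  by exists (p x) => //; apply: pM'; exact: LM.
have [x Mx xy] := pS y M'y.
exists x => //; apply: (submod_closed sL); first exact: submod_HA Mx.
move=> e e0.
have d0 : 0 < Num.max 1 d by rewrite lt_max ltr01.
have [_ [z Lz <-] yz] := yL _ (divr_gt0 e0 d0).
have Mz := LM z Lz; exists z => //.
have Mxz : M (x - z) by exact: submodB.
rewrite (le_lt_trans (pd _ Mxz))// (linear_onB sM lp)// xy.
rewrite (@le_lt_trans _ _ (Num.max 1 d * normH (y - p z)))//.
  by rewrite ler_wpM2r ?normH_ge0// le_max lexx orbT.
by rewrite mulrC -ltr_pdivlMr.
Qed.

End Submodules.

(** * Stability of the decomposition *)

Section Openness.
Variables (R : realType) (A : unitalCStarAlgType R).
Local Notation seqA := (nat -> A).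
Implicit Types (M N : set seqA) (x y : seqA) (F G : Ba A).

Lemma op_linearB F x y : HA x -> HA y -> F (x - y) = F x - F y.
Proof.
by move=> Hx Hy; apply: (linear_onB (HA_submodule A) (@op_linear _ _ F)).
Qed.

(** The supremum is finite because both operators are bounded, so evaluating it
    at x / normH x is legitimate. *)
Lemma opnorm_bound F G (e : R) : opnorm (fun x => G x - F x) < e ->
  forall x, HA x -> normH (G x - F x) <= e * normH x.
Proof.
move=> GFe x Hx.
have [cF cF0 HF] := bounded_on_ge0 (@op_bounded _ _ F).
have [cG cG0 HG] := bounded_on_ge0 (@op_bounded _ _ G).
have [x0|x0] := eqVneq (normH x) 0.
  have -> : x = 0 by exact: normH_eq0 x0.
  rewrite !(linear_on0 (HA_submodule A) (@op_linear _ _ _)).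
  by rewrite subrr normH0 mulr0.
have {}x0 : 0 < normH x by rewrite lt_def x0 normH_ge0.
pose t := (normH x)^-1; have t0 : 0 < t by rewrite invr_gt0.
pose z := rsc t x; have Hz : HA z by exact: HA_rsc.
have z1 : normH z = 1 by rewrite normH_rsc// gtr0_norm// mulVf// gt_eqF.
have Dz : G z - F z = rsc t (G x - F x).
  rewrite /z /rsc !(linear_on_ract (HA_submodule A) (@op_linear _ _ _))//.
  by apply/funext => n; rewrite /ract -[LHS]mulrBl.
have HGF : HA (G x - F x) by apply: HA_sub; exact: op_fun.
have : normH (G z - F z) <= opnorm (fun x => G x - F x).
  apply: ub_le_sup; last by exists z => //=; rewrite z1.
  exists (cG + cF) => _ [w [Hw w1] <-].
  rewrite (le_trans (normHB _ _)) ?lerD//; try exact: op_fun.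
  - by rewrite (le_trans (HG w Hw))// ler_piMr.
  - by rewrite (le_trans (HF w Hw))// ler_piMr.
rewrite Dz normH_rsc// gtr0_norm// /t => h.
by rewrite -ler_pdivrMr// mulrC (le_trans h)// ltW.
Qed.

Definition lift_op F (x : HAspace A) : HAspace A :=
  MkHA (@op_fun _ _ F _ (hvalP x)).

(** The map (m, n) |-> F m + n on M1 x N2 is a bijection with bounded inverse,
    the constant being the product of the one for the splitting M2 (+) N2 and
    the lower bound of F on M1. *)
Lemma perturbed_direct_sum F M1 M2 N2 : closed_submodule M1 ->
  direct_sum M2 N2 -> module_iso M1 M2 F ->
  exists2 e : R, 0 < e & forall G, opnorm (fun x => G x - F x) < e ->
    (forall y, HA y -> exists m n, [/\ M1 m, N2 n & y = G m + n]) /\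
    (exists2 C : R, 0 <= C &
       forall m n, M1 m -> N2 n -> normH m <= C * normH (G m + n)).
Proof.
move=> sM1 dMN [lF [FM _ FS] [K FK] [d Fd]].
have [sM2 sN2 HE _] := dMN.
have [C2 C20 HC2] := direct_sum_bound dMN.
pose C := Num.max 0 d * C2.
have d0 : 0 <= Num.max 0 d by rewrite le_max lexx.
have C0 : 0 <= C by rewrite mulr_ge0.
pose e := (2 * (C + 1))^-1.
have e0 : 0 < e by rewrite invr_gt0 mulr_gt0// ltr_wpDl.
have Ce : C * e <= 1 / 2.
  rewrite /e ler_pdivrMr ?mulr_gt0 ?ltr_wpDl//; lra.
exists e => // G GF.
have GFx := opnorm_bound GF.
pose M := [set x : HAspace A | M1 (hval x)].
pose N := [set x : HAspace A | N2 (hval x)].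
have [] := @perturbed_splitting _ _ M N (lift_op F) (lift_op G) C e
  (submod_closed_subspace sM1) (submod_closed_subspace sN2) _ C0 Ce (ltW e0) K.
- by move=> x y _ _; apply: hval_inj; apply: op_linearB; exact: hvalP.
- by move=> x Mx; exact: FK.
- by move=> x _; apply: GFx; exact: hvalP.
- move=> y; have : HA (hval y) by exact: hvalP.
  rewrite HE => -[_ /FS[m Mm <-] [n Nn mn]].
  exists (MkHA (submod_HA sM1 Mm)), (MkHA (submod_HA sN2 Nn)); split=> //.
  exact: hval_inj.
- move=> m n Mm Nn.
  rewrite /C -mulrA; apply: (@le_trans _ _ (Num.max 0 d * normH (F (hval m)))).
    rewrite (le_trans (Fd _ Mm))// ler_wpM2r ?normH_ge0//.
    by rewrite le_max lexx orbT.
  by rewrite ler_wpM2l//; apply: HC2 => //; exact: FM.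
move=> GS GC; split=> [y Hy|].
  have [m [n [Mm Nn yE]]] := GS (MkHA Hy).
  by exists (hval m), (hval n); split=> //; exact: (congr1 (@hval _ _) yE).
exists (2 * C) => [|m n Mm Nn]; first by rewrite mulr_ge0.
exact: (GC (MkHA (submod_HA sM1 Mm)) (MkHA (submod_HA sN2 Nn))).
Qed.

(** The new summands are N1' = G^-1(N2) and M2' = G(M1).  If G x = G m + n then
    x - m lies in N1', which gives H_A = M1 (+) N1'.  The submodule M2' is
    closed because the N2-part of a limit of points G m' is arbitrarily
    small. *)
Lemma decomposition_stable F M1 N1 M2 N2 : MPhi_decomposition F M1 N1 M2 N2 ->
  exists2 e : R, 0 < e & forall G, opnorm (fun x => G x - F x) < e ->
    exists N1' M2', MPhi_decomposition G M1 N1' M2' N2.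
Proof.
move=> [[d1 d2] FM FN iF [fg1 fg2]].
have [sM1 sN1 _ _] := d1; have [sM2 sN2 _ _] := d2.
have [e e0 He] := perturbed_direct_sum sM1 d2 iF.
exists e => // G GF; have [GS [C C0 GC]] := He G GF.
have HG := @op_fun _ _ G.
have [K K0 GK] := bounded_on_ge0 (@op_bounded _ _ G).
have sH := HA_submodule A; have lG := @op_linear _ _ G.
have G0 : G 0 = 0 := linear_on0 sH lG.
have M1H x : M1 x -> HA x := submod_HA sM1 (x := x).
pose N1' := [set x | HA x /\ N2 (G x)]; pose M2' := G @` M1.
have GM0 m n : M1 m -> N2 n -> G m + n = 0 -> m = 0 /\ n = 0.
  move=> Mm Nn E.
  have m0 : m = 0.
    apply: (normH_eq0 (M1H _ Mm)); apply/eqP; rewrite eq_le normH_ge0 andbT.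
    by have := GC m n Mm Nn; rewrite E normH0 mulr0.
  by split=> //; move: E; rewrite m0 G0 add0r.
have iG : module_iso M1 M2' G.
  split.
  - by move=> x y a /M1H Hx /M1H Hy; exact: lG.
  - split=> [x Mx|x y /set_mem Mx /set_mem My Gxy|//]; first by exists x.
    apply/eqP; rewrite -subr_eq0; apply/eqP.
    apply: (GM0 _ 0 _ (submod0 sN2) _).1; first exact: submodB.
    by rewrite addr0 op_linearB ?Gxy ?subrr//; exact: M1H.
  - by exists K => x /M1H; exact: GK.
  - exists C => x Mx; have := GC x 0 Mx (submod0 sN2).
    by rewrite addr0.
have sN1' : closed_submodule N1'.
  split.
  - by move=> x [].
  - by split; [exact: HA0|rewrite G0; exact: submod0].
  - move=> x y [Hx Nx] [Hy Ny]; split; first exact: HA_add.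
    by rewrite (linear_onD lG)//; exact: submodD.
  - move=> x a [Hx Nx]; split; first exact: HA_ract.
    by rewrite (linear_on_ract sH lG)//; exact: submod_ract.
  - move=> x Hx xN; split=> //; apply: (submod_closed sN2) => [|r r0].
      exact: HG.
    have K1 : 0 < K + 1 by rewrite ltr_wpDl.
    have [y [Hy Ny] xy] := xN _ (divr_gt0 r0 K1); exists (G y) => //.
    rewrite -op_linearB//.
    have Hxy := HA_sub Hx Hy.
    rewrite (le_lt_trans (GK _ Hxy))//.
    rewrite (@le_lt_trans _ _ ((K + 1) * normH (x - y)))//.
      by rewrite ler_wpM2r ?normH_ge0// lerDl.
    by rewrite mulrC -ltr_pdivlMr.
have sM2' : closed_submodule M2'.
  split.
  - by move=> _ [x /M1H Hx <-]; exact: HG.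
  - by exists 0 => //; exact: submod0.
  - move=> _ _ [x Mx <-] [y My <-]; exists (x + y); first exact: submodD.
    by rewrite (linear_onD lG)//; exact: M1H.
  - move=> _ a [x Mx <-]; exists (ract x a); first exact: submod_ract.
    by rewrite (linear_on_ract sH lG)//; exact: M1H.
  - move=> y Hy yM.
    have [m [n [Mm Nn yE]]] := GS y Hy.
    have Hn : HA n := submod_HA sN2 Nn.
    suff n0 : n = 0 by exists m => //; rewrite yE n0 addr0.
    apply: normH_eq0 => //; apply/eqP; rewrite eq_le normH_ge0 andbT.
    apply/ler_addgt0Pr => r r0; rewrite add0r.
    have K1 : 0 < 1 + K * C by rewrite ltr_pwDl// mulr_ge0.
    have [_ [m' Mm' <-] ym'] := yM _ (divr_gt0 r0 K1).
    have Mmm : M1 (m - m') by exact: submodB.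
    have E : y - G m' = G (m - m') + n.
      by rewrite yE op_linearB; [rewrite addrAC|exact: M1H|exact: M1H].
    have nE : n = (y - G m') - G (m - m') by rewrite E addrC addKr.
    have HGm := HG _ (M1H _ Mmm).
    have HyG : HA (y - G m') by apply: HA_sub => //; apply: HG; exact: M1H.
    rewrite nE (le_trans (normHB HyG HGm))//.
    have h1 := GC _ _ Mmm Nn; rewrite -E in h1.
    have h2 := GK _ (M1H _ Mmm).
    have h3 : K * normH (m - m') <= K * (C * normH (y - G m')).
      by rewrite ler_wpM2l.
    move: ym'; rewrite ltr_pdivlMr// => /ltW; lra.
have d1' : direct_sum M1 N1'.
  split=> //.
  - apply/seteqP; split=> [x Hx|_ [m /M1H Hm [n [Hn _] <-]]]; last first.
      exact: HA_add.
    have [m [n [Mm Nn GxE]]] := GS (G x) (HG _ Hx).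
    exists m => //; exists (x - m); last by rewrite addrC subrK.
    split; first by apply: HA_sub => //; exact: M1H.
    by rewrite op_linearB ?GxE; [rewrite addrC addKr|by []|exact: M1H].
  - apply/seteqP; split=> [m [Mm [Hm Nm]]|_ ->]; last first.
      by split; exact: submod0.
    apply: (GM0 m (- G m) Mm (submodN sN2 Nm) _).1.
    by rewrite subrr.
have d2' : direct_sum M2' N2.
  split=> //.
  - apply/seteqP; split=> [y Hy|_ [_ [m /M1H Hm <-] [n Nn <-]]].
      have [m [n [Mm Nn ->]]] := GS y Hy.
      by exists (G m); [exists m|exists n].
    by apply: HA_add; [exact: HG|exact: submod_HA Nn].
  - apply/seteqP; split=> [_ [[m Mm <-] Nm]|_ ->]; last first.
      by split; exact: submod0.
    have [-> _] := GM0 m (- G m) Mm (submodN sN2 Nm) (subrr _).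
    by rewrite G0.
exists N1', M2'; split=> //.
- by move=> x Mx; exists x.
- by move=> x [].
- split=> //; have [p ip] := complements_iso d1 d1'.
  exact: finitely_generated_iso ip fg1.
Qed.

End Openness.

Theorem lemma5p5 (R : realType) (A : unitalCStarAlgType R) :
  open_in_Ba (MPhi_plus_minus A) /\ open_in_Ba (MPhi_minus_plus A).
Proof.
split=> F [M1 [N1 [M2 [N2 [dF [N [u [sN NN iu]]]]]]]].
- have [e e0 He] := decomposition_stable dF; exists e => // G /He[N1' [M2' dG]].
  exists M1, N1', M2', N2; split=> //.
  have [[d1 _] _ _ _ _] := dF; have [[d1' _] _ _ _ _] := dG.
  have [p ip] := complements_iso d1' d1.
  by exists N, (u \o p); split=> //; exact: module_iso_comp iu.
- have [e e0 He] := decomposition_stable dF; exists e => // G /He[N1' [M2' dG]].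
  exists M1, N1', M2', N2; split=> //.
  have [[d1 _] _ _ _ _] := dF; have [[d1' _] _ _ _ _] := dG.
  have [_ sN1 _ _] := d1; have [_ sN1' _ _] := d1'.
  have [p ip] := complements_iso d1 d1'.
  have [spN ipN] := module_iso_image sN1 sN1' ip sN NN.
  exists (p @` N), (p \o u); split=> //; last exact: module_iso_comp ipN.
  by case: ip => _ [pN _ _] _ _ _ [x /NN Nx <-]; exact: pN.
Qed.
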